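(* Let $F_2$ be the free group on $\gamma_1,\gamma_2$. On $\mathcal R^*(F_2,\mathrm{SL}_3(\mathbb C))\setminus\{\tau_{21\bar2\bar1}=\tau_{12\bar1\bar2}\}$ the holomorphic volume form is $$\Omega_{F_2}=\pm\frac{3\sqrt{-3}}{\tau_{21\bar2\bar1}-\tau_{12\bar1\bar2}}\;d\tau_1\wedge d\tau_{\bar1}\wedge d\tau_2\wedge d\tau_{\bar2}\wedge d\tau_{12}\wedge d\tau_{\bar1\bar2}\wedge d\tau_{1\bar2}\wedge d\tau_{\bar12}.$$
   Context: Notation: $\tau_{i_1\cdots i_l}$ is the function $[\rho]\mapsto\operatorname{tr}\rho(\gamma_{i_1}\cdots\gamma_{i_l})$, with the convention $\gamma_{\bar i}=\gamma_i^{-1}$. A representation $\rho\colon F_2\to\mathrm{SL}_3(\mathbb C)$ is good if its image is contained in no proper parabolic subgroup (i.e. it is irreducible) and its centralizer is the center of $\mathrm{SL}_3(\mathbb C)$. $\mathcal R^*(F_2,\mathrm{SL}_3(\mathbb C))$ is the set of conjugacy classes of good representations, a complex manifold of dimension $8$ with $T_{[\rho]}\mathcal R^*(F_2,\mathrm{SL}_3(\mathbb C))\cong H^1(F_2;\operatorname{Ad}\rho)$ (the path $\rho_s$ corresponds to the class of the cocycle $\gamma\mapsto\frac{d}{ds}\rho_s(\gamma)\rho(\gamma)^{-1}|_{s=0}$). Volume form $\Omega_{F_2}$ (Reidemeister torsion, defined up to sign): let $\mathcal B(X,Y)=-\operatorname{tr}(XY)$ on $\mathfrak g=\mathfrak{sl}_3(\mathbb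 C)$. Let $C^0=\mathfrak g$, $C^1=\mathfrak g^2$, $\delta(X)=(\operatorname{Ad}_{\rho(\gamma_i)}X-X)_{i=1}^2$, so that $H^1(F_2;\operatorname{Ad}\rho)=C^1/\operatorname{Im}\delta$. Let $\mathbf c^0$ be a $\mathcal B$-orthonormal basis of $\mathfrak g$ and $\mathbf c^1$ the corresponding basis of $\mathfrak g^2$. For a basis $\mathbf h$ of $H^1(F_2;\operatorname{Ad}\rho)$ with representatives $\widetilde{\mathbf h}\subset C^1$, $\Omega_{F_2}(\wedge\mathbf h)=\pm[\delta\mathbf c^0\sqcup\widetilde{\mathbf h}:\mathbf c^1]$, where $[\mathbf a:\mathbf b]$ is the determinant of the matrix expressing $\mathbf a$ in terms of $\mathbf b$ and $\wedge\mathbf h$ is the exterior product of the elements of $\mathbf h$. *)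

(* Defs.v *)
From HB Require Import structures.
From mathcomp Require Import all_boot all_order all_algebra.
From mathcomp Require Export complex.
From mathcomp Require Import all_classical all_reals all_analysis.

Set Implicit Arguments.
Unset Strict Implicit.
Unset Printing Implicit Defensive.

Import Order.TTheory GRing.Theory Num.Theory.
Import numFieldNormedType.Exports.

Local Open Scope ring_scope.
Local Open Scope classical_set_scope.

Definition free_on (F : groupType) (g1 g2 : F) : Prop :=
  forall (G : groupType) (a1 a2 : G),
    exists f : {multiplicative F -> G},
      [/\ f g1 = a1, f g2 = a2 &
          forall f' : {multiplicative F -> G},
            f' g1 = a1 -> f' g2 = a2 -> f' =1 f].

Section SL3.
Variable C : fieldType.

Record SL3 := MkSL3 { SL3_mx :> 'M[C]_3; _ : \det SL3_mx == 1 }.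

HB.instance Definition _ := [isSub for SL3_mx].
HB.instance Definition _ := [Choice of SL3 by <:].

Fact SL3_one_subproof : \det (1%:M : 'M[C]_3) == 1.
Proof. by rewrite det1. Qed.

Fact SL3_inv_subproof (A : SL3) : \det (invmx A) == 1.
Proof. by rewrite det_inv (eqP (valP A)) invr1. Qed.

Fact SL3_mul_subproof (A B : SL3) : \det (A *m B) == 1.
Proof. by rewrite det_mulmx (eqP (valP A)) (eqP (valP B)) mulr1. Qed.

Definition SL3_one : SL3 := MkSL3 SL3_one_subproof.
Definition SL3_inv (A : SL3) : SL3 := MkSL3 (SL3_inv_subproof A).
Definition SL3_mul (A B : SL3) : SL3 := MkSL3 (SL3_mul_subproof A B).

Lemma SL3_unitmx (A : SL3) : SL3_mx A \in unitmx.
Proof. by rewrite unitmxE (eqP (valP A)) unitr1. Qed.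

Fact SL3_mulA : associative SL3_mul.
Proof. by move=> A B D; apply: val_inj; rewrite /= mulmxA. Qed.

Fact SL3_mul1 : left_id SL3_one SL3_mul.
Proof. by move=> A; apply: val_inj; rewrite /= mul1mx. Qed.

Fact SL3_mulr1 : right_id SL3_one SL3_mul.
Proof. by move=> A; apply: val_inj; rewrite /= mulmx1. Qed.

Fact SL3_mulV : left_inverse SL3_one SL3_inv SL3_mul.
Proof. by move=> A; apply: val_inj; rewrite /= mulVmx ?SL3_unitmx. Qed.

Fact SL3_mulrV : right_inverse SL3_one SL3_inv SL3_mul.
Proof. by move=> A; apply: val_inj; rewrite /= mulmxV ?SL3_unitmx. Qed.

HB.instance Definition _ := isGroup.Build SL3
  SL3_mulA SL3_mul1 SL3_mulr1 SL3_mulV SL3_mulrV.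

(* A proper parabolic subgroup is the stabilizer of a nonempty flag of proper *)
(* nonzero subspaces of C^3 (SL3 acts on column vectors).                     *)
Definition is_flag (U : seq {vspace 'cV[C]_3}) : bool :=
  [&& U != [::],
      all (fun V => (V != 0%VS) && (V != fullv)) U &
      sorted (fun V W => (V <= W)%VS && (V != W)) U].

Definition flag_stabilizer (U : seq {vspace 'cV[C]_3}) : set SL3 :=
  [set A : SL3 | forall V, V \in U -> forall v, v \in V -> A *m v \in V].

Definition proper_parabolic (P : set SL3) : Prop :=
  exists U, is_flag U /\ P = flag_stabilizer U.

Definition center : set SL3 := [set A | forall B, (A * B = B * A)%g].

Definition Ad (A : SL3) (X : 'M[C]_3) : 'M[C]_3 := A *m X *m (A^-1)%g.

Section Representations.
Variable F : groupType.
Implicit Type rho : {multiplicative F -> SL3}.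

Definition centralizer rho : set SL3 :=
  [set A | forall x, (A * rho x = rho x * A)%g].

Definition good rho : Prop :=
  (forall P, proper_parabolic P -> ~ range rho `<=` P) /\
  centralizer rho = center.

Definition tau rho (x : F) : C := \tr (rho x).

End Representations.

Definition sl3 : {vspace 'M[C]_3} := lker (linfun (@mxtrace C 3 : _ -> C^o)).

Definition trace_form (X Y : 'M[C]_3) : C := - \tr (X *m Y).

Definition orthonormal_basis (c : 8.-tuple 'M[C]_3) : Prop :=
  basis_of sl3 c /\
  forall i j : 'I_8, trace_form (tnth c i) (tnth c j) = (i == j)%:R.

Definition cochain := ('M[C]_3 * 'M[C]_3)%type.

Definition C1 : set cochain := [set z | z.1 \in sl3 /\ z.2 \in sl3].

(* [a : b], the determinant of the matrix expressing a in terms of b *)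
Definition basis_det (V : vectType C) n (a b : n.-tuple V) : C :=
  \det (\matrix_(i < n, j < n) coord b j (tnth a i)).

Section Torsion.
Variables (F : groupType) (g1 g2 : F) (rho : {multiplicative F -> SL3}).

Definition delta (X : 'M[C]_3) : cochain :=
  (Ad (rho g1) X - X, Ad (rho g2) X - X).

Definition B1 : set cochain := delta @` [set` sl3].

(* The classes of the components of h form a basis of H^1 = C^1 / B^1. *)
Definition H1_basis (h : 8.-tuple cochain) : Prop :=
  (forall j, C1 (tnth h j)) /\
  forall z, C1 z ->
    exists! a : 'rV[C]_8, B1 (z - \sum_(j < 8) a 0 j *: tnth h j).

(* The value on the exterior product of h of the torsion form computed with   *)
(* the orthonormal basis c; it depends on c only through its sign.            *)
Definition Omega (c : 8.-tuple 'M[C]_3) (h : 8.-tuple cochain) : C :=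
  basis_det [tuple of [tuple of map delta c] ++ h]
            [tuple of [tuple of [seq (X, 0) | X <- c]] ++
                      [tuple of [seq (0, X) | X <- c]]].

End Torsion.

End SL3.

Section Differential.
Variables (C : numFieldType) (F : groupType) (g1 g2 : F).

(* The path p starts at rho, and its velocity is the cochain z (the values at *)
(* g1 and g2 of the cocycle gamma |-> d/ds p_s(gamma) rho(gamma)^-1 |_(s=0)). *)
Definition path_with_velocity (rho : {multiplicative F -> SL3 C})
    (z : cochain C) (p : C -> {multiplicative F -> SL3 C}) : Prop :=
  let velocity (x : F) (X : 'M[C]_3) :=
    is_derive (0 : C^o) (1 : C^o)
      (fun s : C^o => (p s x : 'M[C]_3) *m ((rho x)^-1)%g : 'M[C]_3) X in
  [/\ p 0 =1 rho, velocity g1 z.1 & velocity g2 z.2].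

(* The differential of [rho] |-> tau rho x, evaluated on the class of z: the  *)
(* derivative of tau along a path with velocity z.                            *)
Definition dtau (rho : {multiplicative F -> SL3 C}) (x : F) (z : cochain C) : C :=
  xget 0 [set v | exists2 p, path_with_velocity rho z p &
                  is_derive (0 : C^o) (1 : C^o)
                    (fun s : C^o => tau (p s) x : C^o) v].

(* The value of dtau_(x_1) /\ .. /\ dtau_(x_n) on h_1 /\ .. /\ h_n. *)
Definition wedge_dtau (rho : {multiplicative F -> SL3 C})
    n (x : n.-tuple F) (h : n.-tuple (cochain C)) : C :=
  \det (\matrix_(i < n, j < n) dtau rho (tnth x i) (tnth h j)).

End Differential.

(* Main.v *)
Require Import Defs.
From mathcomp Require Import all_boot all_order all_algebra.
From mathcomp Require Import all_classical all_reals all_analysis.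
From mathcomp Require Import perm ring.
Import GRing.Theory Num.Theory.
Local Open Scope ring_scope.

Set Implicit Arguments.
Unset Strict Implicit.
Unset Printing Implicit Defensive.

(* Put A = rho g1, B = rho g2. The trace functions of the eight words have      *)
(* differentials z |-> tr (X z_1 + Y z_2), with (X, Y) ranging over eight       *)
(* explicit pairs (the noncommutative gradients of the words), all of them in   *)
(* the kernel of the adjoint d^* : (X, Y) |-> (A^-1 X A - X) + (B^-1 Y B - Y)   *)
(* of the coboundary. Multiplying the 16 x 16 matrix defining the torsion by    *)
(* the matrix of these pairs, completed by eight pairs w, makes it block        *)
(* triangular, so that                                                          *)
(*    torsion * det (w, gradients) = det (d^* w) * (wedge of the differentials).*)
(* With w made of pairs (W_i, 0), i < 6, and (0, V_1), (0, V_2), the first      *)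
(* determinant splits into a determinant on gl_3 that only involves A, and one  *)
(* on gl_3 that becomes, with B in companion form, det [B, A] times a 2 x 2     *)
(* minor which also occurs in det (d^* w). Finally                              *)
(* tr [B, A]_g - tr [A, B]_g = det (B A - A B) for the group commutators, and   *)
(* sqrt (- 3) comes from the discriminant of the trace form on gl_3.            *)
(* A and B have companion forms, and the 2 x 2 minor can be chosen nonzero,     *)
(* because B A - A B is invertible.                                             *)

(** Everything compares volumes in gl_3 x gl_3. By [vol2_pairing], the product of the volumes of two
    lists of 18 pairs (one of them transposed) is their Gram determinant for the trace pairing. Let
    z consist of the eight coboundaries, the cochains [h], and the pairs (1, 0), (0, 1).

    Paired with the cochain basis, z gives the torsion times 9: the basis has Gram matrix -1, so
    coordinates are pairings up to sign ([Omega_pairing]). Paired with w and the gradients, z gives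
    a block triangular matrix, because trace functions are invariant under conjugation
    ([pairing_coboundary_gradient]); its second block contains the wedge of the differentials
    ([dtau_word]).

    Dividing the two identities eliminates the volume of z. The volumes that remain come from
    [ad_volume] and [fox_volume]; the nonzero minor d occurs on both sides and cancels, leaving det
    (B A - A B), which [det_commutator] turns into a difference of traces. The constant comes from
    [vol_orthonormal]. All of this is assembled in [torsion_gradient_identity], whose sign depends
    on [c] alone. *)

Ltac ord_cases := case=> [[|[|[|[|[|[|[|[|[|?]]]]]]]]] ?] //.

(** * Determinants of explicit matrices *)

(* Matrices are given by nested lists, for which [ldet] evaluates to a ring     *)
(* expression.                                                                  *)
Section ListMatrices.
Variable R : comNzRingType.
Implicit Types (r : seq R) (m X Y : seq (seq R)).

Definition lmx n m : 'M[R]_n := \matrix_(i < n, j < n) (nth [::] m i)`_j.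

Fixpoint delcol j r : seq R :=
  match j, r with
  | _, [::] => [::]
  | 0, _ :: r' => r'
  | j'.+1, x :: r' => x :: delcol j' r'
  end.

Fixpoint laplace (minor : nat -> R) j r : R :=
  if r is x :: r' then x * minor j - laplace minor j.+1 r' else 0.

Fixpoint ldet n m : R :=
  match n, m with
  | n'.+1, r :: m' => laplace (fun k => ldet n' (map (delcol k) m')) 0 r
  | _, _ => 1
  end.

Lemma nth_delcol j r k : (delcol j r)`_k = r`_(bump j k).
Proof.
elim: j r k => [|j IH] [|x r] [|k] //=; rewrite ?nth_nil //.
by rewrite IH /bump ltnS addnS.
Qed.

Lemma laplaceE (minor : nat -> R) j r :
  laplace minor j r = \sum_(k < size r) (-1) ^+ k * r`_k * minor (j + k)%N.
Proof.
elim: r j => [|x r IH] j /=; first by rewrite big_ord0.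
rewrite big_ord_recl IH /= expr0 mul1r addn0 -sumrN; congr (_ + _).
by apply: eq_bigr => k _; rewrite exprS !mulNr mul1r addSnnS.
Qed.

Lemma size_delcol j r : (j < size r)%N -> size (delcol j r) = (size r).-1.
Proof.
elim: j r => [|j IH] [|x r] //=; rewrite ltnS => jr.
by rewrite IH // prednK // (leq_ltn_trans _ jr).
Qed.

Lemma det_lmx n m : size m = n -> all (fun r => size r == n) m ->
  \det (lmx n m) = ldet n m.
Proof.
elim: n m => [|n IH] [|r m] //=; first by rewrite det_mx00.
case=> sm /andP[/eqP sr am].
rewrite (expand_det_row _ ord0) laplaceE sr; apply: eq_bigr => j _.
rewrite mxE /cofactor /= !add0n mulrCA mulrA; congr (_ * _).
rewrite -IH ?size_map //; last first.
  apply/allP => _ /mapP[q qm ->]; have /eqP sq := allP am q qm.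
  by rewrite size_delcol sq.
congr (\det _); apply/matrixP => a b; rewrite !mxE lift0 /=.
by rewrite (nth_map [::]) ?sm // nth_delcol.
Qed.

(** Entries are functions on natural numbers, so that blocks are obtained by shifting indices,
    without casts between ordinals. *)
Lemma det_lower (m n : nat) (f : nat -> nat -> R) :
  (forall i j, (i < m)%N -> (j < n)%N -> f i (m + j)%N = 0) ->
  \det (\matrix_(i < m + n, j < m + n) f i j) =
  \det (\matrix_(i < m, j < m) f i j) *
  \det (\matrix_(i < n, j < n) f (m + i)%N (m + j)%N).
Proof.
move=> f0; rewrite -[X in \det X]submxK.
have -> : ursubmx (\matrix_(i < m + n, j < m + n) f i j) = 0.
  by apply/matrixP => i j; rewrite !mxE /= f0.
by rewrite det_lblock; congr (_ * _); congr (\det _); apply/matrixP => i j; rewrite !mxE.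
Qed.

Lemma det_upper (m n : nat) (f : nat -> nat -> R) :
  (forall i j, (i < n)%N -> (j < m)%N -> f (m + i)%N j = 0) ->
  \det (\matrix_(i < m + n, j < m + n) f i j) =
  \det (\matrix_(i < m, j < m) f i j) *
  \det (\matrix_(i < n, j < n) f (m + i)%N (m + j)%N).
Proof.
move=> f0; have tr k (g : nat -> nat -> R) : \det (\matrix_(i < k, j < k) g i j) =
    \det (\matrix_(i < k, j < k) g j i).
  by rewrite -det_tr; congr (\det _); apply/matrixP => i j; rewrite !mxE.
rewrite tr (det_lower (f := fun i j => f j i)); last by move=> i j ? ?; exact: f0.
by congr (_ * _); [exact: (tr _ (fun i j => f j i)) |
  exact: (tr _ (fun i j => f (m + j)%N (m + i)%N))].
Qed.

(** The sign is quantified before [f]: it depends on the reordering only, as the uniform sign of the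
    final formula requires. *)
Lemma det_reorder n (s : seq nat) : perm_eq s (iota 0 n) ->
  exists2 e : R, e = 1 \/ e = -1 & forall f : nat -> nat -> R,
    \det (\matrix_(i < n, j < n) f (nth 0%N s i) j) =
    e * \det (\matrix_(i < n, j < n) f i j).
Proof.
move=> sn; have sz : size s = n by rewrite (perm_size sn) size_iota.
have us : uniq s by rewrite (perm_uniq sn) iota_uniq.
have ltn_s (i : 'I_n) : (nth 0%N s i < n)%N.
  have : nth 0%N s i \in iota 0 n by rewrite -(perm_mem sn) mem_nth ?sz.
  by rewrite mem_iota.
have inj : injective (fun i : 'I_n => Ordinal (ltn_s i)).
  by move=> i j [] /eqP; rewrite nth_uniq ?sz // => /eqP/val_inj.
exists ((-1) ^+ perm inj).
  by case: (odd_perm _); [right; rewrite expr1 | left; rewrite expr0].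
move=> f; rewrite -det_perm -det_mulmx -row_permE; congr (\det _).
by apply/matrixP => i j; rewrite !mxE permE.
Qed.

Definition lmul3 X Y : seq (seq R) :=
  match X, Y with
  | [:: [:: a; b; c]; [:: d; e; f]; [:: g; h; i]],
    [:: [:: a'; b'; c']; [:: d'; e'; f']; [:: g'; h'; i']] =>
    [:: [:: a * a' + b * d' + c * g'; a * b' + b * e' + c * h'; a * c' + b * f' + c * i'];
        [:: d * a' + e * d' + f * g'; d * b' + e * e' + f * h'; d * c' + e * f' + f * i'];
        [:: g * a' + h * d' + i * g'; g * b' + h * e' + i * h'; g * c' + h * f' + i * i']]
  | _, _ => [::]
  end.

Definition ladj3 X : seq (seq R) :=
  match X with
  | [:: [:: a; b; c]; [:: d; e; f]; [:: g; h; i]] =>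
    [:: [:: e * i - f * h; c * h - b * i; b * f - c * e];
        [:: f * g - d * i; a * i - c * g; c * d - a * f];
        [:: d * h - e * g; b * g - a * h; a * e - b * d]]
  | _ => [::]
  end.

Definition lopp X := map (map -%R) X.
Definition lsub X Y := [seq [seq q.1 - q.2 | q <- zip p.1 p.2] | p <- zip X Y].

Definition shape33 X := (size X == 3%N) && all (fun r => size r == 3%N) X.

Lemma shape33P X : shape33 X -> exists a b c d e f g h i,
  X = [:: [:: a; b; c]; [:: d; e; f]; [:: g; h; i]].
Proof.
case: X => [|r1 [|r2 [|r3 []]]] //= /and5P[_].
case: r1 => [|a [|b [|c []]]] //=; case: r2 => [|d [|e [|f []]]] //=.
by case: r3 => [|g [|h [|i []]]] //= *; exists a, b, c, d, e, f, g, h, i.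
Qed.

Lemma lmx_mul X Y : shape33 X -> shape33 Y ->
  lmx 3 X *m lmx 3 Y = lmx 3 (lmul3 X Y).
Proof.
move=> /shape33P[a [b [c [d [e [f [g [h [i ->]]]]]]]]].
move=> /shape33P[a' [b' [c' [d' [e' [f' [g' [h' [i' ->]]]]]]]]].
apply/matrixP; ord_cases; ord_cases;
  by rewrite !mxE !big_ord_recl big_ord0 !mxE /= ?addr0 ?addrA.
Qed.

Lemma lmx_opp X : shape33 X -> - lmx 3 X = lmx 3 (lopp X).
Proof.
move=> /shape33P[a [b [c [d [e [f [g [h [i ->]]]]]]]]].
by apply/matrixP; ord_cases; ord_cases; rewrite !mxE.
Qed.

Lemma lmx_sub X Y : shape33 X -> shape33 Y ->
  lmx 3 X - lmx 3 Y = lmx 3 (lsub X Y).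
Proof.
move=> /shape33P[a [b [c [d [e [f [g [h [i ->]]]]]]]]].
move=> /shape33P[a' [b' [c' [d' [e' [f' [g' [h' [i' ->]]]]]]]]].
by apply/matrixP; ord_cases; ord_cases; rewrite !mxE.
Qed.

Lemma lmx_surj (A : 'M[R]_3) : exists2 X, shape33 X & A = lmx 3 X.
Proof.
pose o (k : nat) (lt : (k < 3)%N) := Ordinal lt : 'I_3.
pose i0 := o 0%N isT; pose i1 := o 1%N isT; pose i2 := o 2%N isT.
exists [:: [:: A i0 i0; A i0 i1; A i0 i2]; [:: A i1 i0; A i1 i1; A i1 i2];
  [:: A i2 i0; A i2 i1; A i2 i2]] => //.
by apply/matrixP; ord_cases; ord_cases; rewrite !mxE /=; congr (A _ _); apply: val_inj.
Qed.

End ListMatrices.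

Lemma lmx_inv (R : comUnitRingType) (X : seq (seq R)) : shape33 X -> \det (lmx 3 X) = 1 ->
  invmx (lmx 3 X) = lmx 3 (ladj3 X).
Proof.
move=> sX d1; have uX : lmx 3 X \in unitmx by rewrite unitmxE d1 unitr1.
suff e : lmx 3 X *m lmx 3 (ladj3 X) = 1%:M.
  by rewrite -[RHS](mulKmx uX) e mulmx1.
have [a [b [c [d [e [f [g [h [i E]]]]]]]]] := shape33P sX; subst X.
move: d1; rewrite det_lmx // => /= d1.
rewrite lmx_mul //; apply/matrixP; case=> [[|[|[|?]]] ?] //; case=> [[|[|[|?]]] ?] //;
  rewrite !mxE /= ?mulr1n ?mulr0n; first [by ring | by rewrite -d1; ring].
Qed.

(** * The volume form of the space of 3 x 3 matrices *)

Section Volume.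
Variable F : fieldType.
Implicit Types (X Y : 'M[F]_3) (s : seq 'M[F]_3).

Let o0 : 'I_3 := @Ordinal 3 0 isT.
Let o1 : 'I_3 := @Ordinal 3 1 isT.
Let o2 : 'I_3 := @Ordinal 3 2 isT.

(* Column 0 comes last, so that matrices with zero column 0 are those           *)
(* supported on the first six positions.                                        *)
Definition positions : seq ('I_3 * 'I_3) :=
  [:: (o0, o1); (o1, o1); (o2, o1); (o0, o2); (o1, o2); (o2, o2);
      (o0, o0); (o1, o0); (o2, o0)].

Definition coords X : seq F := [seq X p.1 p.2 | p <- positions].

Definition vol s : F := \det (\matrix_(i < 9, j < 9) (coords s`_i)`_j).

Definition transposes s := [seq X^T | X <- s].

Lemma nth_transposes s i : (transposes s)`_i = (s`_i)^T.
Proof.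
have [lt_is|ge_is] := ltnP i (size s); first by rewrite (nth_map 0).
by rewrite !nth_default ?size_map // trmx0.
Qed.

Lemma size_coords X : size (coords X) = 9%N. Proof. by []. Qed.

Lemma coords_pairing X Y :
  \sum_(k < 9) (coords X)`_k * (coords Y^T)`_k = \tr (X *m Y).
Proof.
rewrite !big_ord_recl big_ord0 /mxtrace !big_ord_recl big_ord0 !mxE.
rewrite !big_ord_recl !big_ord0 /= !mxE.
have e0 : ord0 = o0 by apply: val_inj.
have e1 : lift ord0 ord0 = o1 by apply: val_inj.
have e2 : lift ord0 (lift ord0 ord0) = o2 by apply: val_inj.
rewrite e2 e1 e0; ring.
Qed.

(** The product of the two coordinate matrices is the Gram matrix of the trace form; the
    transposition appears because tr (X Y) matches the entry (i, j) of X with the entry (j, i) of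
    Y. *)
Lemma vol_pairing s t : vol s * vol (transposes t) =
  \det (\matrix_(i < 9, j < 9) \tr (s`_i *m t`_j)).
Proof.
rewrite /vol -[X in _ * X]det_tr -det_mulmx; congr (\det _).
apply/matrixP => i j; rewrite !mxE -coords_pairing; apply: eq_bigr => k _.
by rewrite !mxE nth_transposes.
Qed.

(** Transposition exchanges three pairs of off-diagonal positions, hence is an odd permutation of
    [positions]. *)
Lemma vol_transposes s : vol (transposes s) = - vol s.
Proof.
pose q k (lt : (k < 9)%N) : 'I_9 := Ordinal lt.
pose p : 'S_9 := (tperm (q 0 isT) (q 7 isT) * (tperm (q 2 isT) (q 4 isT) *
  tperm (q 3 isT) (q 8 isT)))%g.
have sp : odd_perm p by rewrite !odd_mul_tperm odd_tperm.
have -> : vol (transposes s) = \det (col_perm p (\matrix_(i < 9, j < 9) (coords s`_i)`_j)).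
  rewrite /vol; congr (determinant _); apply/matrixP => i.
  by ord_cases; rewrite !mxE nth_transposes !permM !permE /= ?mxE.
by rewrite col_permE det_mulmx det_perm odd_permV sp expr1 mulrN1.
Qed.

(** Left multiplication by P acts on each of the three columns separately, hence with determinant
    (det P)^3 on gl_3. *)
Lemma vol_mull P s : vol [seq P *m X | X <- s] = \det P ^+ 3 * vol s.
Proof.
have nthP i : [seq P *m X | X <- s]`_i = P *m s`_i.
  have [lt_is|ge_is] := ltnP i (size s); first by rewrite (nth_map 0).
  by rewrite !nth_default ?size_map // mulmx0.
pose blk (t : seq 'M[F]_3) m : 'M[F]_(9, 3) := \matrix_(i < 9, j < 3) (t`_i) j m.
pose U : 'M[F]_(3 + (3 + 3)) := block_mx P^T 0 0 (block_mx P^T 0 0 P^T).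
have dU : \det U = \det P ^+ 3.
  by rewrite !det_ublock !det_tr !exprS expr0 mulr1.
have blkP m : blk [seq P *m X | X <- s] m = blk s m *m P^T.
  apply/matrixP => i j; rewrite !mxE nthP mxE; apply: eq_bigr => k _.
  by rewrite !mxE mulrC.
have split_mx (t : seq 'M[F]_3) : \matrix_(i < 9, j < 9) (coords t`_i)`_j =
    row_mx (blk t o1) (row_mx (blk t o2) (blk t o0)) :> 'M[F]_(9, 3 + (3 + 3)).
  pose M : 'M[F]_(9, 3 + (3 + 3)) := \matrix_(i < 9, j < 9) (coords t`_i)`_j.
  rewrite -[LHS]/M -[M]hsubmxK -[rsubmx M]hsubmxK.
  congr (row_mx _ (row_mx _ _)); apply/matrixP => i; ord_cases;
    by rewrite !mxE /=; congr (t`_i _ _); apply: val_inj.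
pose V := row_mx (blk s o1) (row_mx (blk s o2) (blk s o0)).
have VU : \matrix_(i < 9, j < 9) (coords [seq P *m X | X <- s]`_i)`_j = V *m U.
  rewrite split_mx !blkP /V /U mul_row_block mul_row_block.
  by rewrite !mulmx0 !addr0 !add0r.
by rewrite -dU mulrC /vol VU (split_mx s); exact: (@det_mulmx _ 9 V U).
Qed.

Lemma vol_mulr P s : vol [seq X *m P | X <- s] = \det P ^+ 3 * vol s.
Proof.
have -> : [seq X *m P | X <- s] = transposes [seq P^T *m X | X <- transposes s].
  by rewrite /transposes -!map_comp; apply: eq_map => X /=; rewrite trmx_mul !trmxK.
by rewrite vol_transposes vol_mull vol_transposes det_tr mulrN opprK.
Qed.

Lemma vol_conj P s : P \in unitmx ->
  vol [seq P *m X *m invmx P | X <- s] = vol s.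
Proof.
move=> uP; have -> : [seq P *m X *m invmx P | X <- s] =
    [seq X *m invmx P | X <- [seq P *m X | X <- s]] by rewrite -map_comp.
rewrite vol_mulr vol_mull mulrA -exprMn det_inv mulVf ?expr1n ?mul1r //.
by rewrite -unitfE -unitmxE.
Qed.

End Volume.

(** * Companion matrices *)

Section Companion.
Variable F : fieldType.
Implicit Types (s t : F).

(** The elementary matrices with zero column 0. They span a complement of the algebra generated by
    any companion matrix, whose elements are determined by their column 0. *)
Definition lcol_units : seq (seq (seq F)) :=
  [:: [:: [:: 0; 1; 0]; [:: 0; 0; 0]; [:: 0; 0; 0]];
      [:: [:: 0; 0; 0]; [:: 0; 1; 0]; [:: 0; 0; 0]];
      [:: [:: 0; 0; 0]; [:: 0; 0; 0]; [:: 0; 1; 0]];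
      [:: [:: 0; 0; 1]; [:: 0; 0; 0]; [:: 0; 0; 0]];
      [:: [:: 0; 0; 0]; [:: 0; 0; 1]; [:: 0; 0; 0]];
      [:: [:: 0; 0; 0]; [:: 0; 0; 0]; [:: 0; 0; 1]]].

Definition col_units : seq 'M[F]_3 := [seq lmx 3 X | X <- lcol_units].

(** Its characteristic polynomial is x^3 - t x^2 + s x - 1, so t is its trace and s the trace of its
    inverse. Its powers 0, 1, 2 send the first basis vector to the three basis vectors. *)
Definition lcompanion s t : seq (seq F) :=
  [:: [:: 0; 0; 1]; [:: 1; 0; - s]; [:: 0; 1; t]].
Definition linv_companion s t : seq (seq F) :=
  [:: [:: s; 1; 0]; [:: - t; 0; 1]; [:: 1; 0; 0]].

Definition companion s t : 'M[F]_3 := lmx 3 (lcompanion s t).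

Lemma det_companion s t : \det (companion s t) = 1.
Proof. by rewrite /companion det_lmx //=; ring. Qed.

Lemma inv_companion s t : invmx (companion s t) = lmx 3 (linv_companion s t).
Proof.
rewrite lmx_inv ?det_companion //; congr lmx; rewrite /linv_companion /=.
by congr [:: [:: _; _; _]; [:: _; _; _]; [:: _; _; _]]; ring.
Qed.

Lemma one_lmx : 1%:M = lmx 3 [:: [:: 1; 0; 0]; [:: 0; 1; 0]; [:: 0; 0; 1]] :> 'M[F]_3.
Proof. by apply/matrixP; ord_cases; ord_cases; rewrite !mxE. Qed.

Definition lcoords (X : seq (seq F)) : seq F :=
  let x i j := (nth [::] X i)`_j in
  [:: x 0%N 1%N; x 1%N 1%N; x 2%N 1%N; x 0%N 2%N; x 1%N 2%N; x 2%N 2%N;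
      x 0%N 0%N; x 1%N 0%N; x 2%N 0%N].

Lemma coords_lmx X : coords (lmx 3 X) = lcoords X.
Proof. by rewrite /coords /= !mxE. Qed.

Lemma vol_units (X Y Z : 'M[F]_3) : vol (col_units ++ [:: X; Y; Z]) =
  ldet 3 [:: drop 6 (coords X); drop 6 (coords Y); drop 6 (coords Z)].
Proof.
rewrite /vol (@det_lower _ 6 3 (fun i j => (coords (col_units ++ [:: X; Y; Z])`_i)`_j)).
  rewrite -[RHS]mul1r -det_lmx //; congr (_ * _).
    rewrite -[RHS](det1 _ 6); congr determinant; apply/matrixP.
    by ord_cases; ord_cases; rewrite !mxE /= ?mxE.
  congr determinant; apply/matrixP.
  by ord_cases; ord_cases; rewrite !mxE.
case=> [|[|[|[|[|[|i]]]]]] //; case=> [|[|[|j]]] //= _ _; by rewrite mxE.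
Qed.

Lemma trace_unit (X : 'M[F]_3) j : (j < 6)%N -> \tr (X *m (col_units`_j)^T) = (coords X)`_j.
Proof.
move=> lt_j; rewrite -coords_pairing trmxK.
case: j lt_j => [|[|[|[|[|[|j]]]]]] // _; rewrite !big_ord_recl big_ord0 /= !mxE /=;
  by rewrite !(mulr0, mulr1, addr0, add0r).
Qed.

Lemma trace_unit_l (X : 'M[F]_3) j : (j < 6)%N -> \tr (col_units`_j *m X) = (coords X^T)`_j.
Proof.
by move=> lt_j; rewrite -trace_unit // -trmx_mul mxtrace_tr.
Qed.

(** The matrices A^-1 X A - X are trace-orthogonal to 1, A and A^-1, which commute with A. Pairing
    with these three and the transposed [col_units], a family of volume -1 after transposition, is
    therefore block triangular. *)
Lemma vol_ad_companion s t P1 P2 P3 (A := companion s t) :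
  vol ([seq invmx A *m X *m A - X | X <- col_units] ++ [:: P1; P2; P3]) =
  - \det (\matrix_(i < 3, j < 3) \tr ([:: P1; P2; P3]`_i *m [:: 1%:M; A; invmx A]`_j)).
Proof.
have uA : A \in unitmx by rewrite unitmxE det_companion unitr1.
set D := [seq _ | X <- _].
pose T := transposes col_units ++ [:: 1%:M; A; invmx A].
have volT : vol (transposes T) = -1.
  have -> : transposes T = col_units ++ [:: 1%:M; A^T; (invmx A)^T].
    by rewrite /transposes map_cat -map_comp (eq_map (@trmxK _ _ _)) map_id /= trmx1.
  by rewrite vol_units /coords /= inv_companion !mxE /=; ring.
rewrite -[LHS]opprK; congr (- _); rewrite -[LHS]mulN1r mulrC -volT vol_pairing.
pose f i j := \tr ((D ++ [:: P1; P2; P3])`_i *m T`_j).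
have sD : size D = 6%N by [].
rewrite (@det_lower _ 6 3 f); last first.
  move=> i j li lj; rewrite /f nth_cat sD li nth_cat size_map ltnNge leq_addr /= addKn.
  rewrite (nth_map 0) // mulmxBl raddfB /=.
  have comm : A *m [:: 1%:M; A; invmx A]`_j = [:: 1%:M; A; invmx A]`_j *m A.
    by case: j lj => [|[|[|j]]] //= _; rewrite ?mulmx1 ?mul1mx // mulmxV // mulVmx.
  rewrite -[X in \tr X - _]mulmxA comm mxtrace_mulC -!mulmxA (mulmxA A) mulmxV //.
  by rewrite mul1mx [X in X - _]mxtrace_mulC subrr.
(* The six by six block turns out to have determinant 1 for all s and t. *)
rewrite -[RHS]mul1r; congr (_ * _).
pose L := [seq lcoords
   (lsub (lmul3 (lmul3 (linv_companion s t) X) (lcompanion s t)) X) | X <- lcol_units].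
have -> : \matrix_(i < 6, j < 6) f i j = lmx 6 L.
  apply/matrixP => i j; rewrite !mxE /f nth_cat sD ltn_ord nth_cat size_map ltn_ord.
  have sh : shape33 (nth [::] lcol_units i) by move: i; ord_cases.
  have ui : col_units`_i = lmx 3 (nth [::] lcol_units i) by rewrite (nth_map [::]).
  have Di : D`_i = invmx A *m col_units`_i *m A - col_units`_i by rewrite (nth_map 0).
  have [a [b [c [d [e [g [h [k [l E]]]]]]]]] := shape33P sh.
  rewrite nth_transposes trace_unit // Di ui /L (nth_map [::]) // E /A inv_companion.
  by rewrite !lmx_mul // lmx_sub // coords_lmx.
have -> : lmx 6 L = lmx 6
    [:: [:: -1; 0; 0; - s * s; s * t; - s]; [:: 0; -1; 0; - s; 0; 0];
        [:: 0; 0; -1; 0; - s; 0]; [:: s; - t; 1; t * s - 1; - (t * t); t];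
        [:: 1; 0; 0; t; -1; 0]; [:: 0; 1; 0; 0; t; -1]].
  by apply/matrixP; ord_cases; ord_cases; rewrite !mxE /=; ring.
rewrite det_lmx //.
cbv beta iota zeta delta [cat take drop map zip delcol ldet laplace nth fst snd].
ring.
Qed.

End Companion.

(** * Volumes modulo the algebra generated by a companion matrix *)

Section FoxCompanion.
Variable F : fieldType.
Implicit Types (s t : F).

Lemma ldet_unit n i (m : seq (seq F)) : (i <= n)%N ->
  ldet n.+1 ([seq (k == i)%:R | k <- iota 0 n.+1] :: m) =
  (-1) ^+ i * ldet n (map (delcol i) m).
Proof.
move=> le_in; rewrite -[LHS]/(laplace (fun k => ldet n (map (delcol k) m)) 0
  [seq (k == i)%:R | k <- iota 0 n.+1]) laplaceE size_map size_iota.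
rewrite (eq_bigr (fun k : 'I_n.+1 => (-1) ^+ k * (k == i :> nat)%:R *
    ldet n (map (delcol k) m))) => [|k _]; last first.
  by rewrite (nth_map 0%N) ?size_iota // nth_iota.
rewrite (bigD1 (Ordinal (le_in : (i < n.+1)%N))) //= big1 ?addr0 => [|k neq_k].
  by rewrite eqxx mulr1.
by rewrite -[_ == i]/(k == Ordinal (le_in : (i < n.+1)%N)) (negPf neq_k) mulr0 mul0r.
Qed.

(* Coordinates of X modulo the algebra generated by companion s t: the          *)
(* element of that algebra with the same column 0 is subtracted.                *)
Definition reduced s t (X : seq (seq F)) : seq F :=
  match X with
  | [:: [:: a; b; c]; [:: d; e; f]; [:: g; h; i]] =>
    [:: b - g; e - a + g * s; h - d - g * t; c - d - g * t;
        f + d * s - g * (1 - s * t); i - a - d * t - g * (t * t - s)]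
  | _ => [::]
  end.

Lemma vol_reduced s t (L : seq (seq (seq F))) : size L = 9%N -> all (@shape33 F) L ->
  vol [seq lmx 3 X | X <- L] =
  \det (lmx 9 [seq reduced s t X ++ drop 6 (lcoords X) | X <- L]).
Proof.
move=> sL aL.
pose M1 : 'M[F]_(9, 6) :=
  \matrix_(i < 9, j < 6) (coords [seq lmx 3 X | X <- L]`_i)`_j.
pose M2 : 'M[F]_(9, 3) :=
  \matrix_(i < 9, j < 3) (coords [seq lmx 3 X | X <- L]`_i)`_(6 + j).
(* The rows are the last two columns of the powers 0, 1, 2 of companion s t.    *)
pose C : 'M[F]_(3, 6) := \matrix_(i < 3, j < 6) (nth [::]
  [:: [:: 0; 1; 0; 0; 0; 1]; [:: 0; 0; 1; 1; - s; t];
      [:: 1; - s; t; t; 1 - s * t; t * t - s]] i)`_j.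
have split_M : \matrix_(i < 9, j < 9) (coords [seq lmx 3 X | X <- L]`_i)`_j = row_mx M1 M2
    :> 'M[F]_(9, 6 + 3).
  rewrite -[LHS](@hsubmxK _ 9 6 3).
  by congr (row_mx _ _); apply/matrixP => i j; rewrite !mxE.
rewrite /vol split_M.
(* Passing to reduced coordinates is a unimodular column operation. *)
pose U : 'M[F]_(6 + 3) := block_mx 1%:M 0 (- C) 1%:M.
have dU : \det U = 1 by rewrite det_lblock !det1 mulr1.
have MU : row_mx (M1 - M2 *m C) M2 = row_mx M1 M2 *m U.
  by rewrite /U mul_row_block !mulmx1 mulmx0 add0r mulmxN.
transitivity (\det (row_mx (M1 - M2 *m C) M2 : 'M[F]_(6 + 3))).
  by rewrite MU -[LHS]mulr1 -dU; exact/esym/(@det_mulmx _ 9 (row_mx M1 M2) U).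
congr determinant; rewrite -[RHS](@hsubmxK _ 9 6 3).
congr (row_mx _ _); apply/matrixP => i j.
  rewrite !mxE !big_ord_recl big_ord0 !mxE !(nth_map [::]) ?sL //.
  have /shape33P[a [b [c [d [e [g [h [k [l E]]]]]]]]] : shape33 (nth [::] L i).
    by apply: (allP aL); rewrite mem_nth ?sL.
  by rewrite E coords_lmx; move: j; ord_cases; rewrite /=; ring.
rewrite !mxE !(nth_map [::]) ?sL //.
have /shape33P[a [b [c [d [e [g [h [k [l E]]]]]]]]] : shape33 (nth [::] L i).
  by apply: (allP aL); rewrite mem_nth ?sL.
by rewrite E coords_lmx; move: j; ord_cases.
Qed.

Lemma size_reduced s t X : shape33 X -> size (reduced s t X) = 6%N.
Proof. by case/shape33P => [a [b [c [d [e [g [h [k [l ->]]]]]]]]]. Qed.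

(** The matrices in [M] lie in the algebra of the companion matrix, so only their column 0 survives
    reduction and the determinant splits. *)
Lemma vol_mod_companion s t (L M : seq (seq (seq F))) :
  size L = 6%N -> size M = 3%N -> all (@shape33 F) L -> all (@shape33 F) M ->
  (forall X, X \in M -> reduced s t X = nseq 6 0) ->
  vol [seq lmx 3 X | X <- L ++ M] =
  ldet 6 [seq reduced s t X | X <- L] * ldet 3 [seq drop 6 (lcoords X) | X <- M].
Proof.
move=> sL sM aL aM M0.
have shL i : (i < 6)%N -> shape33 (nth [::] L i).
  by move=> li; apply: (allP aL); rewrite mem_nth ?sL.
rewrite (@vol_reduced s t) ?size_cat ?sL ?sM ?all_cat ?aL ?aM //.
pose f i j := (nth [::] [seq reduced s t X ++ drop 6 (lcoords X) | X <- L ++ M] i)`_j.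
rewrite /lmx (@det_upper _ 6 3 f); last first.
  move=> i j li lj; rewrite /f (nth_map [::]) ?size_cat ?sL ?sM ?ltn_add2l //.
  rewrite nth_cat sL ltnNge leq_addr /= addKn M0 ?mem_nth ?sM //.
  by rewrite nth_cat size_nseq lj nth_nseq lj.
rewrite -!det_lmx ?size_map //; last 2 first.
- by rewrite all_map; apply/allP.
- by rewrite all_map; apply: sub_all aL => X /(size_reduced s t) /= ->.
congr (_ * _); congr determinant; apply/matrixP => i j; rewrite !mxE /f.
  rewrite !(nth_map [::]) ?size_cat ?sL ?sM ?(ltn_addr _ (ltn_ord i)) //.
  by rewrite nth_cat sL ltn_ord nth_cat size_reduced ?ltn_ord // shL.
rewrite !(nth_map [::]) ?size_cat ?sL ?sM ?ltn_add2l //.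
rewrite [nth _ (L ++ M) _]nth_cat sL ltnNge leq_addr /= addKn nth_cat M0 ?mem_nth ?sM //.
by rewrite size_nseq ltnNge leq_addr /= addKn.
Qed.

(** B, B^-1 and 1 lie in the algebra of B, which leaves a six by six determinant of reduced
    coordinates. There V and W become unit rows, and expanding along them leaves a four by four
    determinant. *)
Lemma vol_fox_companion s t (A : 'M[F]_3) i j (B := companion s t) :
  (i < j < 6)%N -> \det A = 1 ->
  let V := (col_units F)`_i in let W := (col_units F)`_j in
  let u := B *m A *m invmx B - A in
  let v := B *m invmx A *m invmx B - invmx A in
  vol [:: V; W; B *m A; - (invmx A *m invmx B); - (A *m invmx B); B *m invmx A;
          B; - invmx B; 1%:M] =
  - \det (B *m A - A *m B) * (\tr (V *m u) * \tr (W *m v) - \tr (W *m u) * \tr (V *m v)).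
Proof.
move=> /andP[ij j6] dA; have i6 := ltn_trans ij j6.
rewrite /= !trace_unit_l //.
have [X shX EA] := lmx_surj A; move: dA; rewrite {A}EA => dA.
rewrite (lmx_inv shX dA) /B inv_companion one_lmx /companion.
have [a [b [c [d [e [f [g [h [k E]]]]]]]]] := shape33P shX; subst X.
rewrite !lmx_mul // !lmx_sub // !lmx_opp //.
rewrite [\det _]det_lmx //.
have trlmx Y n : (n < 6)%N -> shape33 Y -> (coords (lmx 3 Y)^T)`_n =
   (nth [::] Y (nth 0 [:: 1; 1; 1; 2; 2; 2] n)%N)`_(nth 0 [:: 0; 1; 2; 0; 1; 2] n)%N.
  by case: n => [|[|[|[|[|[|n]]]]]] //= _ _; rewrite !mxE.
rewrite !trlmx //.
rewrite /col_units !(nth_map [::]) //.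
have shU n : (n < 6)%N -> shape33 (nth [::] (lcol_units F) n).
  by case: n => [|[|[|[|[|[|n]]]]]].
have redU n : (n < 6)%N ->
    reduced s t (nth [::] (lcol_units F) n) = [seq (m == n)%:R | m <- iota 0 6].
  by case: n => [|[|[|[|[|[|n]]]]]] //= _; congr [:: _; _; _; _; _; _]; ring.
rewrite -[vol _]/(vol [seq lmx 3 X | X <- [:: _; _; _; _; _; _] ++ [:: _; _; _]]).
rewrite (@vol_mod_companion s t) //; first last.
- by move=> Y; rewrite !inE => /or3P[] /eqP -> /=; congr [:: _; _; _; _; _; _]; ring.
- by rewrite /= !shU.
(* Deleting column i, which precedes j, moves the unit of the second row to position j - 1. *)
have delU : delcol i [seq (m == j)%:R | m <- iota 0 6] =
    [seq (m == j.-1)%:R | m <- iota 0 5] :> seq F.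
  by case: i j ij j6 {i6} => [|[|[|[|[|[|i]]]]]] [|[|[|[|[|[|j]]]]]].
rewrite !map_cons !redU // ldet_unit; last by rewrite -ltnS.
rewrite map_cons delU ldet_unit; last by case: (j) j6.
clear delU redU shU trlmx.
(* Each of the fifteen pairs i < j gives a polynomial identity in s, t and the entries of A, the
   inverse of A having been replaced by its adjugate. *)
case: i j ij j6 {i6} => [|[|[|[|[|[|i]]]]]] [|[|[|[|[|[|j]]]]]] // _ _;
cbv beta iota zeta delta [cat take drop map zip delcol ldet laplace nth fst snd
  lmul3 lsub lopp ladj3 lcompanion linv_companion lcoords reduced predn Nat.pred];
ring.
Qed.

End FoxCompanion.

(** * Existence of companion forms *)

Section Cyclic.
Variable F : fieldType.
Implicit Types (A B N : 'M[F]_3).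

(** With N = A - a, the commutator equals N B - B N, whose rank is at most twice that of N. *)
Lemma rank_sub_scalar A B (a : F) : A *m B - B *m A \in unitmx ->
  (1 < \rank (A - a%:M)%R)%N.
Proof.
set N := A - _ => uK.
have KE : A *m B - B *m A = N *m B - B *m N.
  by rewrite mulmxBl mulmxBr mul_scalar_mx mul_mx_scalar opprB addrA subrK.
have := mxrank_unit uK; rewrite KE => rK.
have : (3 <= \rank N + \rank N)%N.
  rewrite -[X in (X <= _)%N]rK (leq_trans (mxrank_add _ _)) // leq_add ?mxrankM_maxl //.
  by rewrite mxrank_opp mxrankM_maxr.
by case: (\rank N) => [|[|]].
Qed.

(** A and B act by scalars on a common eigenline, so their commutator kills it. *)
Lemma no_common_eigenline A B (S : 'M[F]_3) : A *m B - B *m A \in unitmx ->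
  \rank S = 1%N -> (S *m A <= S)%MS -> (S *m B <= S)%MS -> False.
Proof.
move=> uK r1 SA SB; pose n := nz_row S.
have S0 : S != 0 by rewrite -mxrank_eq0 r1.
have n0 : n != 0 by rewrite nz_row_eq0.
have nS : (n == S)%MS.
  by rewrite -(geq_leqif (mxrank_leqif_eq (nz_row_sub S))) r1 lt0n mxrank_eq0.
have eig X : (S *m X <= S)%MS -> exists a, n *m X = a *: n.
  move=> SX; apply/sub_rVP; rewrite (eqmxP nS) (submx_trans _ SX) //.
  by rewrite submxMr // nz_row_sub.
have [a nA] := eig _ SA; have [b nB] := eig _ SB.
have : n *m (A *m B - B *m A) = 0.
  by rewrite mulmxBr !mulmxA nA nB -!scalemxAl nA nB !scalerA mulrC subrr.
move/(congr1 (mulmx^~ (invmx (A *m B - B *m A)))).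
by rewrite mulmxK // mul0mx => /eqP; apply/negP.
Qed.

(** The image and the kernel of N are stable under A and B; for N singular and nonzero, one of the
    two is a line. *)
Lemma schur_commutator A B N : A *m B - B *m A \in unitmx ->
  N *m A = A *m N -> N *m B = B *m N -> N \notin unitmx -> N = 0.
Proof.
move=> uK NA NB nuN; apply: contrapT => /eqP N0.
have stabN X : N *m X = X *m N -> (N *m X <= N)%MS by move=> ->; exact: submxMl.
have stabK X : N *m X = X *m N -> (kermx N *m X <= kermx N)%MS.
  by move=> NX; apply/sub_kermxP; rewrite -mulmxA -NX mulmxA mulmx_ker mul0mx.
have : (\rank N <= 2)%N.
  by rewrite -ltnS ltn_neqAle rank_leq_row andbT; apply: contra nuN; rewrite -row_free_unit.
case rN : (\rank N) => [|[|[|]]] // _.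
- by move/eqP: rN; rewrite mxrank_eq0 (negPf N0).
- exact: (no_common_eigenline uK rN (stabN _ NA) (stabN _ NB)).
- apply: (no_common_eigenline uK _ (stabK _ NA) (stabK _ NB)).
  by rewrite mxrank_ker rN.
Qed.

Definition krylov A (v : 'rV[F]_3) : 'M[F]_3 := \matrix_(i < 3) (v *m A ^+ i).

Lemma krylov_sub A v i : (i < 3)%N -> (v *m A ^+ i <= krylov A v)%MS.
Proof.
move=> lt_i; rewrite -(rowK (fun i : 'I_3 => v *m A ^+ i) (Ordinal lt_i)).
exact: row_sub.
Qed.

Lemma krylov_sub0 A v : (v <= krylov A v)%MS.
Proof. by have := krylov_sub A v (isT : (0 < 3)%N); rewrite expr0 mulmx1. Qed.

Lemma krylov_sub1 A v : (v *m A <= krylov A v)%MS.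
Proof. by have := krylov_sub A v (isT : (1 < 3)%N); rewrite expr1. Qed.

Lemma exists_not_eigen A : (forall a : F, (1 < \rank (A - a%:M)%R)%N) ->
  exists u : 'rV[F]_3, ~~ (u *m A <= u)%MS.
Proof.
move=> rA; apply: contrapT => none.
have eig (u : 'rV[F]_3) : exists a, u *m A = a *: u.
  by apply/sub_rVP; apply: contrapT => /negP nu; apply: none; exists u.
pose d (i : 'I_3) : 'rV[F]_3 := delta_mx 0 i.
have [a ea] := eig (d 0).
suff A0 : A - a%:M = 0 by have := rA a; rewrite A0 mxrank0.
apply/row_matrixP => i; rewrite row0 rowE mulmxBr mul_mx_scalar -/(d i).
have [<-|i0] := eqVneq 0 i; first by rewrite ea subrr.
have [b eb] := eig (d i); have [c] := eig (d 0 + d i).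
rewrite mulmxDl ea eb scalerDr => /rowP e.
have := e 0; have := e i; rewrite !mxE !eqxx eq_sym (negPf i0) /=.
rewrite !mulr0 !mulr1 !addr0 !add0r.
by move=> -> ->; rewrite subrr.
Qed.

(** A matrix with one-dimensional eigenspaces has a cyclic vector. A vector u that is no eigenvector
    is cyclic unless it spans with u A an invariant plane U; the second case takes most of the
    proof. *)
Lemma exists_krylov_unit A : (forall a : F, (1 < \rank (A - a%:M)%R)%N) ->
  exists v, krylov A v \in unitmx.
Proof.
move=> rA; have [u nu] := exists_not_eigen rA.
pose U := col_mx u (u *m A).
have rU : \rank U = 2%N.
  apply/eqP; rewrite eqn_leq rank_leq_row ltnNge; apply: (contra _ nu) => rU.
  have uU : (u <= U)%MS by rewrite -addsmxE addsmxSl.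
  have u0 : u != 0 by apply: contraNneq nu => ->; rewrite mul0mx sub0mx.
  have : (u == U)%MS.
    by rewrite -(geq_leqif (mxrank_leqif_eq uU)) (leq_trans rU) // lt0n mxrank_eq0.
  by move/eqmxP=> ->; rewrite -addsmxE addsmxSr.
have unitK w (y : 'rV[F]_3) : (U <= krylov A w)%MS -> (y <= krylov A w)%MS ->
    ~~ (y <= U)%MS -> krylov A w \in unitmx.
  move=> UK yK yU; rewrite -row_free_unit /row_free eqn_leq rank_leq_row.
  have ltU : (U < U + y)%MS.
    by rewrite ltmxE addsmxSl /=; apply: contra yU; exact/submx_trans/addsmxSr.
  have := rank_ltmx ltU; rewrite rU => /leq_trans; apply.
  by rewrite mxrankS // addsmx_sub UK.
have subU m (X : 'M[F]_(m, 3)) : (u <= X)%MS -> (u *m A <= X)%MS -> (U <= X)%MS.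
  by move=> uX uAX; rewrite -addsmxE addsmx_sub uX.
have [inU|ninU] := boolP (u *m A ^+ 2 <= U)%MS; last first.
  exists u; apply: (unitK u (u *m A ^+ 2)) => //; last exact: krylov_sub.
  by apply: subU; [exact: krylov_sub0 | exact: krylov_sub1].
have UA : (U *m A <= U)%MS.
  rewrite mul_col_mx -addsmxE addsmx_sub -mulmxA -[A *m A]/(A ^+ 2) inU andbT.
  by rewrite -addsmxE addsmxSr.
(* phi spans the annihilator of the invariant plane U, hence is an eigenvector  *)
(* of A^T, of eigenvalue a say; by the rank hypothesis U is the image of A - a, *)
(* and any preimage of u outside U is a cyclic vector.                          *)
have rk : \rank (kermx U^T) = 1%N by rewrite mxrank_ker mxrank_tr rU.
pose phi := nz_row (kermx U^T).
have phi0 : phi != 0 by rewrite nz_row_eq0 -mxrank_eq0 rk.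
have phiP : (phi == kermx U^T)%MS.
  by rewrite -(geq_leqif (mxrank_leqif_eq (nz_row_sub _))) rk lt0n mxrank_eq0.
have [a phiA] : exists a, phi *m A^T = a *: phi.
  apply/sub_rVP; rewrite (eqmxP phiP); apply/sub_kermxP.
  have /submxP[D DU] := UA.
  rewrite -mulmxA -trmx_mul DU trmx_mul mulmxA.
  by have /sub_kermxP -> := nz_row_sub (kermx U^T); rewrite mul0mx.
have rphi : \rank phi^T = 1%N by rewrite mxrank_tr rank_rV phi0.
have rkphi : \rank (kermx phi^T) = 2%N by rewrite mxrank_ker rphi.
have Uphi : (U :=: kermx phi^T)%MS.
  apply/eqmxP; rewrite -(geq_leqif (mxrank_leqif_eq _)) ?rkphi ?rU //.
  apply/sub_kermxP/trmx_inj; rewrite trmx_mul trmxK trmx0.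
  by apply/sub_kermxP/nz_row_sub.
pose N := A - a%:M.
have Nphi : N *m phi^T = 0.
  apply: trmx_inj; rewrite trmx_mul trmxK trmx0 /N raddfB /= tr_scalar_mx.
  by rewrite mulmxBr phiA mul_mx_scalar subrr.
have NU : (N :=: U)%MS.
  apply: eqmx_trans (eqmx_sym Uphi); apply/eqmxP.
  by rewrite -(geq_leqif (mxrank_leqif_eq _)) ?rkphi ?rA //; apply/sub_kermxP.
have /submxP[w wN] : (u <= N)%MS by rewrite NU -addsmxE addsmxSl.
have NA : N *m A = A *m N.
  by rewrite /N mulmxBl mulmxBr mul_scalar_mx mul_mx_scalar.
suff [w' w'N w'U] : exists2 w' : 'rV[F]_3, u = w' *m N & ~~ (w' <= U)%MS.
  exists w'; apply: (unitK w' w'); rewrite ?w'U ?krylov_sub0 //.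
  have K0 := krylov_sub0 A w'; have K1 := krylov_sub1 A w'.
  have K2 : (w' *m A *m A <= krylov A w')%MS.
    by rewrite -mulmxA; exact: (krylov_sub A w' (isT : (2 < 3)%N)).
  apply: subU; rewrite w'N /N mulmxBr mul_mx_scalar ?mulmxBl -?scalemxAl.
    by rewrite addmx_sub // eqmx_opp scalemx_sub.
  by rewrite addmx_sub // eqmx_opp scalemx_sub.
have [wU|] := boolP (w <= U)%MS; last by exists w.
have rN : \rank N = 2%N by rewrite NU.
(* If w lies in U, then N maps U onto itself, hence is injective on U. So the kernel vector n is
   outside U, and w + n is the preimage sought. *)
pose n := nz_row (kermx N).
have nN : n *m N = 0 by apply/sub_kermxP/nz_row_sub.
have n0 : n != 0 by rewrite nz_row_eq0 -mxrank_eq0 mxrank_ker rN.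
exists (w + n); first by rewrite mulmxDl nN addr0.
apply/negP => wnU; have nU : (n <= U)%MS by rewrite -[n](addKr w) addmx_sub // eqmx_opp.
have : (\rank U <= \rank (U *m N))%N.
  apply/mxrankS/subU; first by rewrite wN submxMr.
  by rewrite wN -mulmxA NA mulmxA submxMr // (submx_trans _ UA) // submxMr.
rewrite -(mxrank_mul_ker U N) -[X in (_ <= X)%N]addn0 leq_add2l leqn0.
rewrite mxrank_eq0 => /eqP cap0.
have : (n <= (U :&: kermx N)%MS)%MS by rewrite sub_capmx nU; apply/sub_kermxP.
by rewrite cap0 submx0 (negPf n0).
Qed.

End Cyclic.

(** * Conjugation to companion form, and transport of volumes *)

Section Conjugation.
Variable F : fieldType.
Implicit Types (A B P X Y : 'M[F]_3).

Definition mxconj P X := P *m X *m invmx P.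

Lemma mxconjM P X Y : P \in unitmx -> mxconj P (X *m Y) = mxconj P X *m mxconj P Y.
Proof. by move=> uP; rewrite /mxconj !mulmxA mulmxKV. Qed.

Lemma mxconjB P X Y : mxconj P (X - Y) = mxconj P X - mxconj P Y.
Proof. by rewrite /mxconj mulmxBr mulmxBl. Qed.

Lemma mxconjN P X : mxconj P (- X) = - mxconj P X.
Proof. by rewrite /mxconj mulmxN mulNmx. Qed.

Lemma mxconj1 P : P \in unitmx -> mxconj P 1%:M = 1%:M.
Proof. by move=> uP; rewrite /mxconj mulmx1 mulmxV. Qed.

Lemma mxconjK P X : P \in unitmx -> mxconj P (mxconj (invmx P) X) = X.
Proof. by move=> uP; rewrite /mxconj invmxK !mulmxA mulmxV // mul1mx mulmxK. Qed.

Lemma mxconjVK P X : P \in unitmx -> mxconj (invmx P) (mxconj P X) = X.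
Proof. by move=> uP; rewrite -{2}[P]invmxK mxconjK ?unitmx_inv. Qed.

Lemma det_mxconj P X : P \in unitmx -> \det (mxconj P X) = \det X.
Proof.
move=> uP; rewrite /mxconj !det_mulmx det_inv mulrAC mulfV ?mul1r //.
by rewrite -unitfE -unitmxE.
Qed.

Lemma tr_mxconj P X : P \in unitmx -> \tr (mxconj P X) = \tr X.
Proof. by move=> uP; rewrite /mxconj mxtrace_mulC mulKmx. Qed.

Lemma mxconj_inv P X : P \in unitmx -> \det X = 1 ->
  invmx (mxconj P X) = mxconj P (invmx X).
Proof.
move=> uP dX; have uX : X \in unitmx by rewrite unitmxE dX unitr1.
have uc : mxconj P X \in unitmx by rewrite unitmxE det_mxconj // dX unitr1.
by rewrite -[RHS](mulKmx uc) -mxconjM // mulmxV // mxconj1 // mulmx1.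
Qed.

Lemma companion_form A B : A *m B - B *m A \in unitmx -> \det A = 1 ->
  exists P s t, P \in unitmx /\ A = mxconj P (companion s t).
Proof.
move=> uK dA.
(* Krylov spaces are built from row vectors, while [companion] acts on columns; hence the passage to
   A^T. The corner entry is then 1 because the determinant is. *)
have uKt : A^T *m B^T - B^T *m A^T \in unitmx.
  by rewrite -!trmx_mul -raddfB /= unitmx_tr -opprB -scaleN1r unitmxZ // unitrN1.
have [v uv] := exists_krylov_unit (fun a => rank_sub_scalar a uKt).
set K := krylov _ v in uv; pose C := K *m A^T *m invmx K.
have rowC (i j : 'I_3) : j = i.+1 :> nat -> row i C = row j 1%:M.
  move=> ji; rewrite -(mulmxV uv) !row_mul; congr (_ *m _).
  by rewrite !rowK ji exprSr mulmxA.
have dC : \det C = 1.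
  by rewrite (det_mxconj (P := K)) // det_tr.
pose i0 : 'I_3 := @Ordinal 3 0 isT; pose i1 : 'I_3 := @Ordinal 3 1 isT.
pose i2 : 'I_3 := @Ordinal 3 2 isT.
have C0 j : C i0 j = (i1 == j)%:R.
  by have /rowP/(_ j) := rowC i0 i1 erefl; rewrite !mxE.
have C1 j : C i1 j = (i2 == j)%:R.
  by have /rowP/(_ j) := rowC i1 i2 erefl; rewrite !mxE.
have CE : C = lmx 3 [:: [:: 0; 1; 0]; [:: 0; 0; 1]; [:: C i2 i0; C i2 i1; C i2 i2]].
  apply/matrixP => -[[|[|[|//]]] ltk] j; rewrite [RHS]mxE.
  - by rewrite (_ : Ordinal ltk = i0) ?C0; [move: j; ord_cases | exact: val_inj].
  - by rewrite (_ : Ordinal ltk = i1) ?C1; [move: j; ord_cases | exact: val_inj].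
  - rewrite (_ : Ordinal ltk = i2); last exact: val_inj.
    by move: j; ord_cases; congr (C _ _); apply: val_inj.
have x1 : C i2 i0 = 1.
  have : \det C = C i2 i0 by rewrite [in LHS]CE det_lmx //=; ring.
  by rewrite dC => <-.
exists K^T, (- C i2 i1), (C i2 i2); split; first by rewrite unitmx_tr.
have -> : companion (- C i2 i1) (C i2 i2) = C^T.
  rewrite [in RHS]CE x1 /companion /lcompanion opprK; apply/matrixP.
  by ord_cases; ord_cases; rewrite !mxE.
apply: trmx_inj; rewrite /mxconj !trmx_mul !trmxK trmx_inv trmxK /C.
by rewrite !mulmxA mulVmx // mul1mx mulmxKV.
Qed.

(** [W] is the conjugate of [col_units] by the matrix that brings A to companion form; conjugation
    preserves both volumes and traces. *)
Lemma ad_volume A B : A *m B - B *m A \in unitmx -> \det A = 1 ->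
  exists W : seq 'M[F]_3, [/\ size W = 6%N,
    vol (W ++ [:: A; - invmx A; 1%:M]) = -1 &
    forall P1 P2 P3 : 'M[F]_3,
      vol ([seq invmx A *m X *m A - X | X <- W] ++ [:: P1; P2; P3]) =
      - \det (\matrix_(i < 3, j < 3)
               \tr ([:: P1; P2; P3]`_i *m [:: 1%:M; A; invmx A]`_j))].
Proof.
move=> uK dA; have [P [s [t [uP EA]]]] := companion_form uK dA.
have dC := det_companion s t; have iA := mxconj_inv uP dC.
exists [seq mxconj P X | X <- col_units F]; split => //.
- rewrite EA iA -(mxconj1 uP) -mxconjN.
  rewrite -[_ ++ _]/([seq mxconj P X | X <- col_units F ++ [:: _; _; _]]).
  rewrite /mxconj vol_conj //.
  by rewrite vol_units /coords /= inv_companion !mxE /=; ring.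
- move=> P1 P2 P3.
  rewrite EA iA -map_comp.
  rewrite (eq_map (g := mxconj P \o
      (fun X => invmx (companion s t) *m X *m companion s t - X))); last by move=> X /=; rewrite -!mxconjM // -mxconjB.
  have Q X : X = mxconj P (mxconj (invmx P) X) by rewrite mxconjK.
  rewrite map_comp {1}(Q P1) {1}(Q P2) {1}(Q P3).
  rewrite -[X in _ ++ X]/[seq mxconj P X | X <- [:: _; _; _]] -map_cat vol_conj //.
  rewrite vol_ad_companion; congr (- \det _); apply/matrixP => i j; rewrite !mxE.
  move: i j; ord_cases; ord_cases; rewrite /= -(tr_mxconj _ uP) mxconjM // mxconjK //.
  all: by rewrite ?mxconj1.
Qed.

End Conjugation.

(** * Choice of two matrices for which the 2 x 2 minor is nonzero *)

Section Fox.
Variable C : numClosedFieldType.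
Implicit Types (A B : 'M[C]_3).

Lemma independent_vectors n (x y : 'I_n -> C) :
  (forall a b : C, (forall k, a * x k + b * y k = 0) -> a = 0 /\ b = 0) ->
  exists i j : 'I_n, (i < j)%N /\ x i * y j - x j * y i != 0.
Proof.
move=> ind; apply: contrapT => none.
have all0 i j : x i * y j - x j * y i = 0.
  apply: contrapT => /eqP nz; apply: none.
  case: (ltngtP i j) => ij; first by exists i, j.
    by exists j, i; split=> //; rewrite -oppr_eq0 opprB.
  by rewrite (val_inj ij) subrr eqxx in nz.
have x0 i : x i = 0.
  have [] := ind (y i) (- x i); last by move=> _ /eqP; rewrite oppr_eq0 => /eqP.
  by move=> k; rewrite mulNr mulrC -(all0 k i) (mulrC (x i)).
have [] := ind 1 0; last by move=> /eqP; rewrite oner_eq0.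
by move=> k; rewrite x0 mulr0 mul0r addr0.
Qed.

(** M commutes with A and B, so subtracting one of its eigenvalues gives 0 by [schur_commutator].
    But 1, A, A^-1 are linearly independent, as column 0 shows in companion form. *)
Lemma ad_inverse_independent A B (a b : C) :
  B *m A - A *m B \in unitmx -> \det A = 1 ->
  let M := a *: A + b *: invmx A in M *m B = B *m M -> a = 0 /\ b = 0.
Proof.
move=> uK dA M MB; have uA : A \in unitmx by rewrite unitmxE dA unitr1.
have MA : M *m A = A *m M.
  by rewrite mulmxDl mulmxDr -!scalemxAl -!scalemxAr mulVmx // mulmxV.
have uK' : A *m B - B *m A \in unitmx by rewrite -opprB -scaleN1r unitmxZ // unitrN1.
have [l /eigenvalueP[v vM v0]] := eigenvalue_closed M (isT : (0 < 3)%N).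
have Ml : M - l%:M = 0.
  apply: (schur_commutator uK').
  - by rewrite mulmxBl mulmxBr MA mul_scalar_mx mul_mx_scalar.
  - by rewrite mulmxBl mulmxBr MB mul_scalar_mx mul_mx_scalar.
  apply/negP => uM; case/negP: v0; rewrite -(mulmxK uM v).
  by rewrite mulmxBr vM mul_mx_scalar subrr mul0mx.
have [P [s [t [uP EA]]]] := companion_form uK' dA.
have : mxconj P (a *: companion s t + b *: lmx 3 (linv_companion s t) - l%:M) = 0.
  rewrite -inv_companion -Ml /M EA (mxconj_inv uP (det_companion s t)).
  rewrite /mxconj mulmxBr mulmxBl mulmxDr mulmxDl -!scalemxAr -!scalemxAl.
  by rewrite mul_mx_scalar -scalemxAl mulmxV // scalemx1.
move/(congr1 (mxconj (invmx P))); rewrite mxconjVK //.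
rewrite /mxconj mulmx0 mul0mx => /matrixP E.
have := E (@Ordinal 3 1 isT) (@Ordinal 3 0 isT).
have := E (@Ordinal 3 2 isT) (@Ordinal 3 0 isT).
rewrite !mxE /= !mulr0n !mulr1 !mulr0 !subr0 add0r => -> /eqP.
by rewrite mul0r addr0 => /eqP ->.
Qed.

(** In companion form for B, V and W are chosen among the [col_units]. If all minors vanished, some
    nontrivial combination of A and A^-1 would commute with B. *)
Lemma fox_volume A B : B *m A - A *m B \in unitmx -> \det A = 1 -> \det B = 1 ->
  exists V W : 'M[C]_3,
  let u := B *m A *m invmx B - A in
  let v := B *m invmx A *m invmx B - invmx A in
  let d := \tr (V *m u) * \tr (W *m v) - \tr (W *m u) * \tr (V *m v) in
  d != 0 /\
  vol [:: V; W; B *m A; - (invmx A *m invmx B); - (A *m invmx B); B *m invmx A;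
          B; - invmx B; 1%:M] = - \det (B *m A - A *m B) * d.
Proof.
move=> uK dA dB; have [P [s [t [uP EB]]]] := companion_form uK dB.
have [A' EA] : exists A', A = mxconj P A' by exists (mxconj (invmx P) A); rewrite mxconjK.
have uP' : invmx P \in unitmx by rewrite unitmx_inv.
have dA' : \det A' = 1 by rewrite -(det_mxconj A' uP) -EA.
pose B' := companion s t; have dB' : \det B' = 1 := det_companion s t.
pose u' := B' *m A' *m invmx B' - A'.
pose v' := B' *m invmx A' *m invmx B' - invmx A'.
have uK' : B' *m A' - A' *m B' \in unitmx.
  by move: uK; rewrite EB EA -!mxconjM // -mxconjB !unitmxE det_mxconj.
have uB' : B' \in unitmx by rewrite unitmxE dB' unitr1.
have [] := @independent_vectors 6 (fun k => \tr ((col_units C)`_k *m u'))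
  (fun k => \tr ((col_units C)`_k *m v')).
  move=> a b ab0; apply: (ad_inverse_independent uK' dA').
  set M := a *: A' + b *: invmx A'; pose N := B' *m M *m invmx B' - M.
  have NE : N = a *: u' + b *: v'.
    rewrite /N /M mulmxDr mulmxDl -!scalemxAr -!scalemxAl !scalerBr opprD.
    by rewrite addrACA.
  (* Only row 0 of N can be nonzero. Its three entries are then killed by the traces against 1, B
     and B^-1, to which N is orthogonal. *)
  have N12 (k : 'I_6) : (coords N^T)`_k = 0.
    by rewrite -trace_unit_l // NE mulmxDr -!scalemxAr mxtraceD !mxtraceZ ab0.
  have trN X : X *m B' = B' *m X -> \tr (N *m X) = 0.
    move=> XB; rewrite mulmxBl raddfB /= -(mulmxA _ (invmx B')) mxtrace_mulC !mulmxA.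
    rewrite -(mulmxA _ X) XB !mulmxA mulVmx // mul1mx mxtrace_mulC subrr //.
  suff N0 : N = 0.
    by apply/esym/eqP; rewrite -subr_eq0 -[X in X - _](mulmxKV uB') -mulmxBl -/N N0 mul0mx.
  have [X shX NX] := lmx_surj N.
  have [x [y [z [d [e [f [g [h [k EX]]]]]]]]] := shape33P shX; subst X.
  have N12' n (lt_n : (n < 6)%N) := N12 (Ordinal lt_n).
  have := N12' 0%N isT; have := N12' 1%N isT; have := N12' 2%N isT.
  have := N12' 3%N isT; have := N12' 4%N isT; have := N12' 5%N isT.
  rewrite NX /coords /= !mxE /= => k0 h0 g0 f0 e0 d0; subst d e f g h k.
  have := trN 1%:M; have := trN B' erefl; have := trN (invmx B').
  rewrite mulmxV // mulVmx // mulmx1 mul1mx mulmx1 => /(_ erefl).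
  rewrite NX /B' inv_companion !lmx_mul // /mxtrace !big_ord_recl !big_ord0 !mxE /=.
  move=> tr_inv tr1 /(_ erefl) tr0.
  have x0 : x = 0 by move: tr0; rewrite !addr0.
  have y0 : y = 0 by move: tr1; rewrite !(mulr0, mul0r, mulr1, addr0, add0r).
  have z0 : z = 0.
    by move: tr_inv; rewrite x0 y0 !(mulr0, mul0r, mulr1, addr0, add0r).
  by rewrite x0 y0 z0; apply/matrixP; ord_cases; ord_cases; rewrite !mxE.
move=> i [j [ij d0]].
exists (mxconj P (col_units C)`_i), (mxconj P (col_units C)`_j) => u v.
have uE : u = mxconj P u'.
  by rewrite /u EB EA mxconj_inv // -!mxconjM // -mxconjB.
have vE : v = mxconj P v'.
  by rewrite /v EB EA !mxconj_inv // -!mxconjM // -mxconjB.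
rewrite uE vE -!mxconjM // !tr_mxconj //; split=> //.
rewrite EB EA !mxconj_inv // -!mxconjM // -mxconjB -!mxconjN det_mxconj // -(mxconj1 uP).
rewrite -[X in vol X]/[seq mxconj P X | X <- [:: _; _; _; _; _; _; _; _; _]] vol_conj //.
by apply: vol_fox_companion; rewrite ?ij ?ltn_ord.
Qed.

End Fox.

(** * The torsion identity *)

Section PairVolume.
Variable F : fieldType.
Local Notation mx := 'M[F]_3.
Implicit Types (z f : mx * mx) (s t : seq (mx * mx)).

Definition pairing z f : F := \tr (z.1 *m f.1) + \tr (z.2 *m f.2).

Definition coords2 z : seq F := coords z.1 ++ coords z.2.

Definition vol2 s : F := \det (\matrix_(i < 18, j < 18) (coords2 s`_i)`_j).

Definition transposes2 s := [seq (z.1^T, z.2^T) | z <- s].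

Lemma nth_transposes2 s i : (transposes2 s)`_i = ((s`_i).1^T, (s`_i).2^T).
Proof.
have [lt_is|ge_is] := ltnP i (size s); first by rewrite (nth_map 0).
by rewrite !nth_default ?size_map //= trmx0.
Qed.

Lemma vol2_pairing s t : vol2 s * vol2 (transposes2 t) =
  \det (\matrix_(i < 18, j < 18) pairing s`_i t`_j).
Proof.
rewrite /vol2 -[X in _ * X]det_tr -det_mulmx; congr (\det _).
apply/matrixP => i j; rewrite !mxE /pairing -!coords_pairing.
rewrite (@big_split_ord _ _ _ 9 9); congr (_ + _); apply: eq_bigr => k _;
  rewrite !mxE nth_transposes2 /coords2 !nth_cat !size_coords.
  by rewrite /= ltn_ord.
by rewrite /= addKn.
Qed.

Lemma vol2_block (s : seq mx) t : size s = 9%N ->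
  vol2 ([seq (X, 0) | X <- s] ++ t) = vol s * vol [seq z.2 | z <- t].
Proof.
move=> ss; set l := _ ++ t; pose f i j := (coords2 l`_i)`_j.
have l1 i : (i < 9)%N -> l`_i = (s`_i, 0).
  by move=> lt_i; rewrite nth_cat size_map ss lt_i (nth_map 0) ?ss.
have l2 i : l`_(9 + i) = t`_i.
  by rewrite nth_cat size_map ss ltnNge leq_addr /= addKn.
rewrite /vol2 (@det_lower _ 9 9 f); last first.
  move=> i j li lj; rewrite /f l1 // /coords2 nth_cat /= addKn.
  by case: j lj => [|[|[|[|[|[|[|[|[|]]]]]]]]] //= _; rewrite mxE.
congr (_ * _); congr determinant; apply/matrixP => i j; rewrite !mxE /f.
  by rewrite l1 // /coords2 nth_cat size_coords ltn_ord.
rewrite l2 /coords2 nth_cat /= addKn; congr ((coords _)`_ _).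
have [lt_is|ge_is] := ltnP i (size t); first by rewrite (nth_map 0).
by rewrite !nth_default ?size_map.
Qed.

Lemma vol2_reorder (o : seq nat) : perm_eq o (iota 0 18) ->
  exists2 e : F, e = 1 \/ e = -1 & forall s, vol2 [seq s`_k | k <- o] = e * vol2 s.
Proof.
move=> po; have [e e1 eP] := det_reorder F po; exists e => // s.
rewrite /vol2 -(eP (fun i j => (coords2 s`_i)`_j)); congr determinant.
apply/matrixP => i j; rewrite !mxE (nth_map 0%N) //.
by rewrite (perm_size po) size_iota.
Qed.

End PairVolume.

(** For K = A B A^-1 B^-1 one has B A - A B = (1 - K) B A, and the characteristic polynomial of K at
    1 gives det (1 - K) = tr K^-1 - tr K since det K = 1. *)
Lemma det_commutator (F : fieldType) (A B : 'M[F]_3) : \det A = 1 -> \det B = 1 ->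
  \tr (B *m A *m invmx B *m invmx A) - \tr (A *m B *m invmx A *m invmx B) =
  \det (B *m A - A *m B).
Proof.
move=> dA dB; have uA : A \in unitmx by rewrite unitmxE dA unitr1.
have uB : B \in unitmx by rewrite unitmxE dB unitr1.
pose K := A *m B *m invmx A *m invmx B.
have dK : \det K = 1 by rewrite !det_mulmx !det_inv dA dB !invr1 !mulr1.
have iK : invmx K = B *m A *m invmx B *m invmx A.
  have uK : K \in unitmx by rewrite unitmxE dK unitr1.
  apply: (can_inj (mulKmx uK)); rewrite mulmxV // /K !mulmxA.
  by rewrite mulmxKV // mulmxKV // mulmxK // mulmxV.
have -> : B *m A - A *m B = (1%:M - K) *m (B *m A).
  by rewrite mulmxBl mul1mx /K !mulmxA !mulmxKV.
rewrite -iK -/K det_mulmx det_mulmx dA dB !mulr1.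
have [X shX KX] := lmx_surj K; move: dK; rewrite {iK K}KX => dK.
rewrite lmx_inv // one_lmx lmx_sub //; move: dK.
have [a [b [c [d [e [f [g [h [k ->]]]]]]]]] := shape33P shX.
rewrite !det_lmx //= /mxtrace !big_ord_recl !big_ord0 !mxE /= => dK.
(* Writing 0 as det K - 1 makes the goal a polynomial identity in the entries of K. *)
apply/eqP; rewrite -subr_eq0 -[X in _ == X](subrr 1) -[X in _ == X - _]dK; apply/eqP.
by ring.
Qed.

(** * Comparison of the two Gram determinants *)

Section Main.
Variable C : numClosedFieldType.
Local Notation mx := 'M[C]_3.
Implicit Types (A B : mx).

Definition word_gradients A B : seq (mx * mx) :=
  let A' := invmx A in let B' := invmx B in
  [:: (A, 0); (- A', 0); (0, B); (0, - B'); (A *m B, B *m A);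
      (- (B' *m A'), - (A' *m B')); (A *m B', - (A *m B')); (- (B *m A'), B *m A')].

Definition coboundary A B (X : mx) : mx * mx :=
  (A *m X *m invmx A - X, B *m X *m invmx B - X).

Lemma coboundary_adjoint A B X (f : mx * mx) : A \in unitmx -> B \in unitmx ->
  pairing (coboundary A B X) f =
  \tr (X *m ((invmx A *m f.1 *m A - f.1) + (invmx B *m f.2 *m B - f.2))).
Proof.
move=> uA uB; rewrite /pairing /= mulmxDr mxtraceD !mulmxBl !mulmxBr !raddfB /=.
by congr (_ - _ + (_ - _)); rewrite -!mulmxA mxtrace_mulC !mulmxA.
Qed.

(** Coboundaries are tangent to the conjugation orbit, on which trace functions are constant. *)
Lemma pairing_coboundary_gradient A B X k : A \in unitmx -> B \in unitmx ->
  pairing (coboundary A B X) (word_gradients A B)`_k = 0.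
Proof.
move=> uA uB; rewrite coboundary_adjoint //.
suff -> : invmx A *m ((word_gradients A B)`_k).1 *m A - ((word_gradients A B)`_k).1 +
   (invmx B *m ((word_gradients A B)`_k).2 *m B - ((word_gradients A B)`_k).2) = 0.
  by rewrite mulmx0 mxtrace0.
have z0 : invmx A *m 0 *m A - 0 + (invmx B *m 0 *m B - 0) = 0 :> mx.
  by rewrite !mulmx0 !mul0mx !subrr addr0.
case: k => [|[|[|[|[|[|[|[|k]]]]]]]] /=; last by rewrite nth_nil.
all: rewrite ?mulmxN ?mulNmx ?opprK ?mulmx0 ?mul0mx ?subrr ?oppr0 ?addr0 ?add0r ?mulmxA.
all: rewrite ?(mulVmx uA) ?(mulVmx uB) ?mul1mx ?mulmxKV ?(mulmxK uA) ?(mulmxK uB) //.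
all: rewrite ?subrr ?addrN ?addNr //.
all: rewrite ?addrA ?subrK ?subrr ?addNr //.
- by rewrite addrK addNr.
- by rewrite [X in X + _]addrAC subrr add0r addNr.
- by rewrite [X in X - _]addrAC addNr add0r subrr.
Qed.

Section Constant.
Variable c : seq mx.
Hypotheses (size_c : size c = 8%N) (tr_c : forall i, (i < 8)%N -> \tr c`_i = 0)
  (ortho_c : forall i j, (i < 8)%N -> (j < 8)%N -> \tr (c`_i *m c`_j) = - (i == j)%:R).

Let kappa := vol (c ++ [:: 1%:M]).

(** The Gram matrix of [c] and 1 is diagonal, with eight entries -1 and one entry tr 1 = 3;
    [vol_transposes] contributes the minus sign. *)
Lemma vol_orthonormal : kappa ^+ 2 = - 3.
Proof.
apply: oppr_inj; rewrite opprK expr2 -mulrN -vol_transposes vol_pairing.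
pose f i j := \tr ((c ++ [:: 1%:M])`_i *m (c ++ [:: 1%:M])`_j).
have c1 i : (i < 8)%N -> (c ++ [:: 1%:M])`_i = c`_i by move=> li; rewrite nth_cat size_c li.
have c8 : (c ++ [:: 1%:M])`_8 = 1%:M by rewrite nth_cat size_c.
rewrite (@det_lower _ 8 1 f); last first.
  by move=> i [|j] // li _; rewrite /f c1 // c8 mulmx1 tr_c.
have -> : \matrix_(i < 8, j < 8) f i j = - 1%:M.
  by apply/matrixP => i j; rewrite !mxE /f !c1 // ortho_c.
rewrite -scaleN1r detZ det1 mulr1 -signr_odd /= expr0 mul1r.
by rewrite det_mx11 mxE /f c8 mulmx1 mxtrace1.
Qed.

Definition dual_cochains := [seq (X, 0) | X <- c] ++ [seq (0, X) | X <- c] : seq (mx * mx).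

Lemma torsion_gradient_identity : exists2 sign : C, sign = 1 \/ sign = -1 &
  forall A B (h : seq (mx * mx)), \det A = 1 -> \det B = 1 ->
    \det (B *m A - A *m B) != 0 -> size h = 8%N ->
    (forall i, (i < 8)%N -> \tr (h`_i).1 = 0 /\ \tr (h`_i).2 = 0) ->
    \det (\matrix_(i < 16, j < 16)
      pairing ([seq coboundary A B X | X <- c] ++ h)`_i dual_cochains`_j) =
    sign * (3 * sqrtC (- 3) / \det (B *m A - A *m B)) *
    \det (\matrix_(i < 8, j < 8) pairing h`_i (word_gradients A B)`_j).
Proof.
(* o1 and o2 separate the pairs supported on the first factor from the others   *)
(* in the lists f and cc below.                                                 *)
pose o1 := [:: 0; 1; 2; 3; 4; 5; 8; 9; 16; 6; 7; 12; 13; 14; 15; 10; 11; 17]%N.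
pose o2 := [:: 0; 1; 2; 3; 4; 5; 6; 7; 16; 8; 9; 10; 11; 12; 13; 14; 15; 17]%N.
have [e1 e1P reo1] := @vol2_reorder C o1 isT.
have [e2 e2P reo2] := @vol2_reorder C o2 isT.
have kk : (kappa / sqrtC (- 3)) ^+ 2 = 1.
  by rewrite expr_div_n vol_orthonormal sqrtCK divff // oppr_eq0 pnatr_eq0.
have s0 : sqrtC (- 3) != 0 :> C by rewrite sqrtC_eq0 oppr_eq0 pnatr_eq0.
(* Two reordering signs and kappa over its normalization, all independent of A, B and h. *)
exists (- (e1 * e2 * (kappa / sqrtC (- 3)))).
  have : (- (e1 * e2 * (kappa / sqrtC (- 3)))) ^+ 2 == 1.
    rewrite sqrrN exprMn kk mulr1 exprMn.
    by case: e1P => ->; case: e2P => ->; rewrite ?sqrrN ?expr1n ?mulr1.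
  by rewrite sqrf_eq1 => /orP[] /eqP ->; [left | right].
move=> A B h dA dB D0 sh trh.
have uA : A \in unitmx by rewrite unitmxE dA unitr1.
have uB : B \in unitmx by rewrite unitmxE dB unitr1.
have uK : B *m A - A *m B \in unitmx by rewrite unitmxE unitfE.
have uK' : A *m B - B *m A \in unitmx by rewrite -opprB -scaleN1r unitmxZ // unitrN1.
have [W [sW volW volD]] := ad_volume uK' dA.
have [V1 [V2 [d0 volV]]] := fox_volume uK dA dB.
set d := _ - _ in d0 volV; set D := \det _ in volV D0 *.
(* These complete lists of pairs of traceless matrices to lists of 18 pairs in gl_3 x gl_3; their
   Gram determinant is 9. *)
pose ones : seq (mx * mx) := [:: (1%:M, 0); (0, 1%:M)].
pose z := [seq coboundary A B X | X <- c] ++ (h ++ ones).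
pose cc := dual_cochains ++ ones.
pose w : seq (mx * mx) := [seq (X, 0) | X <- W] ++ [:: (0, V1); (0, V2)].
pose f := w ++ (word_gradients A B ++ ones).
set Om := \det _; set wd := \det (\matrix_(i < 8, j < 8) _).
have det_ones : \det (\matrix_(i < 2, j < 2) pairing ones`_i ones`_j) = 9.
  have -> : \matrix_(i < 2, j < 2) pairing ones`_i ones`_j = lmx 2 [:: [:: 3; 0]; [:: 0; 3]].
    apply/matrixP; case=> [[|[|?]] ?] //; case=> [[|[|?]] ?] //; rewrite !mxE /pairing /=;
      by rewrite ?mul0mx ?mulmx0 ?mulmx1 ?mxtrace1 ?mxtrace0 ?addr0 ?add0r.
  by rewrite det_lmx //=; ring.
have pairing_ones x j : (j < 2)%N -> \tr x.1 = 0 -> \tr x.2 = 0 -> pairing x ones`_j = 0.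
  case: j => [|[|j]] // _ x1 x2; rewrite /pairing /= ?mulmx0 ?mulmx1 ?mxtrace0.
    by rewrite x1 addr0.
  by rewrite x2 addr0.
have cob_i i : (i < 8)%N -> [seq coboundary A B X | X <- c]`_i = coboundary A B c`_i.
  by move=> li; rewrite (nth_map 0) ?size_c.
have tr_cob X : \tr (coboundary A B X).1 = 0 /\ \tr (coboundary A B X).2 = 0.
  by rewrite !raddfB /= !tr_mxconj // !subrr.
have zcc : vol2 z * vol2 (transposes2 cc) = Om * 9.
  have sdual : size dual_cochains = 16%N by rewrite size_cat !size_map size_c.
  have scob : size ([seq coboundary A B X | X <- c] ++ h) = 16%N.
    by rewrite size_cat size_map size_c sh.
  have z1 i : (i < 16)%N -> z`_i = ([seq coboundary A B X | X <- c] ++ h)`_i.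
    by move=> li; rewrite /z catA nth_cat scob li.
  have z2 i : z`_(16 + i) = ones`_i.
    by rewrite /z catA nth_cat scob ltnNge leq_addr /= addKn.
  have cc1 i : (i < 16)%N -> cc`_i = dual_cochains`_i.
    by move=> li; rewrite nth_cat sdual li.
  have cc2 i : cc`_(16 + i) = ones`_i by rewrite nth_cat sdual ltnNge leq_addr /= addKn.
  rewrite vol2_pairing (@det_lower _ 16 2 (fun i j => pairing z`_i cc`_j)); last first.
    move=> i j li lj; rewrite z1 // cc2 nth_cat size_map size_c.
    case: ltnP => ci; first by rewrite cob_i //; case: (tr_cob c`_i); exact: pairing_ones.
    by case: (trh (i - 8)%N); [rewrite ltn_subLR | exact: pairing_ones].
  rewrite -det_ones; congr (_ * _); congr determinant; apply/matrixP => i j.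
    by rewrite !mxE z1 // cc1.
  by rewrite !mxE z2 cc2.
have zf : vol2 z * vol2 (transposes2 f) = kappa * d * (wd * 9).
  have scob : size [seq coboundary A B X | X <- c] = 8%N by rewrite size_map size_c.
  have sw : size w = 8%N by rewrite size_cat size_map sW.
  have z1 i : (i < 8)%N -> z`_i = coboundary A B c`_i.
    by move=> li; rewrite nth_cat scob li cob_i.
  have z2 i : z`_(8 + i) = (h ++ ones)`_i by rewrite nth_cat scob ltnNge leq_addr /= addKn.
  have f1 i : (i < 8)%N -> f`_i = w`_i by move=> li; rewrite nth_cat sw li.
  have f2 i : f`_(8 + i) = (word_gradients A B ++ ones)`_i.
    by rewrite nth_cat sw ltnNge leq_addr /= addKn.
  have g1 i : (i < 8)%N -> (word_gradients A B ++ ones)`_i = (word_gradients A B)`_i.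
    by move=> li; rewrite nth_cat li.
  have g2 i : (word_gradients A B ++ ones)`_(8 + i) = ones`_i.
    by rewrite nth_cat ltnNge leq_addr /= addKn.
  have h1 i : (i < 8)%N -> (h ++ ones)`_i = h`_i by move=> li; rewrite nth_cat sh li.
  have h2 i : (h ++ ones)`_(8 + i) = ones`_i by rewrite nth_cat sh ltnNge leq_addr /= addKn.
  rewrite vol2_pairing (@det_lower _ 8 10 (fun i j => pairing z`_i f`_j)); last first.
    move=> i j li lj; rewrite z1 // f2; have [lj8|gej] := ltnP j 8.
      by rewrite g1 // pairing_coboundary_gradient.
    rewrite -(subnKC gej) g2; case: (tr_cob c`_i); apply: pairing_ones.
    by rewrite ltn_subLR.
  congr (_ * _); last first.
    rewrite (@det_lower _ 8 2 (fun i j => pairing z`_(8 + i) f`_(8 + j))); last first.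
      by move=> i j li lj; rewrite z2 f2 h1 // g2; case: (trh i li); apply: pairing_ones.
    rewrite -det_ones; congr (_ * _); congr determinant; apply/matrixP => i j;
      rewrite !mxE z2 f2.
      by rewrite h1 // g1.
    by rewrite h2 g2.
  pose P1 := invmx B *m V1 *m B - V1; pose P2 := invmx B *m V2 *m B - V2.
  (* A matrix of trace 1 completes the traceless d^* w_j to nine matrices, to be paired with [c] and
     1. The other entries of its row do not affect the determinant. *)
  pose P3 : mx := delta_mx 0 0.
  pose L := [seq invmx A *m X *m A - X | X <- W] ++ [:: P1; P2; P3].
  have trP3 : \tr P3 = 1 by rewrite /P3 /mxtrace !big_ord_recl big_ord0 !mxE /= !addr0.
  have trP (V X : mx) : \tr ((invmx B *m V *m B - V) *m X) =
      \tr (V *m (B *m X *m invmx B - X)).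
    by rewrite mulmxBl mulmxBr !raddfB /= -!mulmxA mxtrace_mulC !mulmxA.
  have volL : vol L = - d.
    rewrite volD; congr (- _).
    have -> : \matrix_(i < 3, j < 3) \tr ([:: P1; P2; P3]`_i *m [:: 1%:M; A; invmx A]`_j) =
      lmx 3 [:: [:: 0; \tr (V1 *m (B *m A *m invmx B - A));
                      \tr (V1 *m (B *m invmx A *m invmx B - invmx A))];
                [:: 0; \tr (V2 *m (B *m A *m invmx B - A));
                      \tr (V2 *m (B *m invmx A *m invmx B - invmx A))];
                [:: 1; \tr (P3 *m A); \tr (P3 *m invmx A)]].
      apply/matrixP; ord_cases; ord_cases; rewrite !mxE /= ?trP ?mulmx1 //;
        by rewrite mulmxV // subrr mulmx0 mxtrace0.
    by rewrite det_lmx //= /d; ring.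
  have := vol_pairing (c ++ [:: 1%:M]) L; rewrite vol_transposes volL opprK -/kappa => ->.
  pose g i j := \tr ((c ++ [:: 1%:M])`_i *m L`_j).
  have c1 i : (i < 8)%N -> (c ++ [:: 1%:M])`_i = c`_i by move=> li; rewrite nth_cat size_c li.
  have c8 : (c ++ [:: 1%:M])`_8 = 1%:M by rewrite nth_cat size_c.
  have Lw j : (j < 8)%N -> L`_j =
      (invmx A *m (w`_j).1 *m A - (w`_j).1) + (invmx B *m (w`_j).2 *m B - (w`_j).2).
    move=> lj; rewrite /L /w !nth_cat !size_map sW; case: ltnP => j6.
      by rewrite !(nth_map 0) ?sW //= mulmx0 mul0mx subrr addr0.
    have : (j - 6 < 2)%N by rewrite ltn_subLR.
    by case: (j - 6)%N => [|[|]] //= _; rewrite mulmx0 mul0mx subrr add0r.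
  have L8 : L`_8 = P3 by rewrite nth_cat size_map sW.
  rewrite (@det_upper _ 8 1 g); last first.
    move=> [|i] j // _ lj; rewrite /g c8 mul1mx Lw // raddfD !raddfB /=.
    by rewrite -!mulmxA !(mxtrace_mulC (invmx _)) !mulmxK // !subrr addr0.
  rewrite det_mx11 mxE /g c8 mul1mx L8 trP3 mulr1; congr determinant.
  by apply/matrixP => i j; rewrite !mxE z1 // f1 // c1 // coboundary_adjoint // Lw.
have volcc : e2 * vol2 (transposes2 cc) = - 3.
  rewrite -reo2.
  have -> : [seq (transposes2 cc)`_k | k <- o2] =
      [seq (X, 0) | X <- transposes (c ++ [:: 1%:M])] ++
      [seq (0, X) | X <- transposes (c ++ [:: 1%:M])].
    rewrite /cc /dual_cochains.
    move: (c) size_c => -[|c0 [|c1 [|c2 [|c3 [|c4 [|c5 [|c6 [|c7 []]]]]]]]] //= _.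
    by rewrite !trmx0 !trmx1.
  rewrite vol2_block ?size_map ?size_cat ?size_c // -map_comp map_id.
  by rewrite vol_transposes mulrNN -expr2 vol_orthonormal.
have volf : e1 * vol2 (transposes2 f) = D * d.
  rewrite -reo1.
  set s := [seq _ | k <- _].
  pose L := [:: V1; V2; B *m A; - (invmx A *m invmx B); - (A *m invmx B); B *m invmx A;
          B; - invmx B; 1%:M].
  pose M := W ++ [:: A; - invmx A; 1%:M].
  have -> : s = [seq (X, 0) | X <- transposes M] ++
      zip [:: 0; 0; (A *m B)^T; (- (invmx B *m invmx A))^T; (A *m invmx B)^T;
        (- (B *m invmx A))^T; 0; 0; 0] (transposes L).
    rewrite /s /f /w /M.
    move: (W) sW => -[|W0 [|W1 [|W2 [|W3 [|W4 [|W5 []]]]]]] //= _.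
    by rewrite !trmx0 !trmx1.
  rewrite vol2_block ?size_map ?size_cat ?sW // -[map _ (zip _ _)]/(unzip2 _) unzip2_zip //.
  by rewrite !vol_transposes volW volV mulrNN -/D; ring.
have e22 : e2 * e2 = 1 by case: e2P => ->; rewrite ?mulrNN mulr1.
(* Both Gram identities are multiplied so that the volume of z disappears; then 9 and the nonzero
   minor d cancel. *)
have OmD : Om * D * e2 = - (3 * e1 * kappa * wd).
  have n9 : 9 != 0 :> C by rewrite pnatr_eq0.
  apply: (mulfI (mulf_neq0 n9 d0)).
  transitivity (Om * 9 * (D * d) * e2); first by ring.
  rewrite -zcc -volf.
  transitivity (vol2 z * vol2 (transposes2 f) * e1 * (e2 * vol2 (transposes2 cc))).
    by ring.
  by rewrite zf volcc; ring.
apply: (mulIf D0); transitivity (Om * D * e2 * e2); first by rewrite -mulrA e22 mulr1.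
rewrite OmD; set r := sqrtC _ in s0 *.
by field; rewrite s0 D0.
Qed.

End Constant.

End Main.

(** * Differentials of the trace functions *)

Import numFieldNormedType.Exports.

Section MatrixDerivative.
Local Open Scope classical_set_scope.
Variable K : numFieldType.
Implicit Types (f g : K -> 'M[K]_3).

Lemma is_derive_inj (V W : normedModType K) (f : V -> W) a v X Y :
  is_derive a v f X -> is_derive a v f Y -> X = Y.
Proof. by move=> [_ <-] [_ <-]. Qed.

Definition entry_derive f (X : 'M[K]_3) :=
  forall i j, is_derive (0 : K^o) (1 : K^o) (fun s : K^o => f s i j : K^o) (X i j).

Lemma is_derive_entry f X :
  is_derive (0 : K^o) (1 : K^o) (f : K^o -> 'M[K]_3) X -> entry_derive f X.
Proof.
move=> [df <-] i j; set D := 'D_ _ _ _.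
have cf : h^-1 *: (f (h *: (1 : K^o) + 0) i j - f 0 i j) @[h --> (0 : K)^'] --> D i j.
  rewrite (_ : (fun h : K => _) = (fun M : 'M[K]_3 => M i j) \o
      (fun h => h^-1 *: ((f \o shift (0 : K^o)) (h *: (1 : K^o)) - f 0))).
    exact: cvg_comp _ _ df (@coord_continuous K _ _ i j D).
  by apply/funext => h; rewrite /= !mxE.
apply: DeriveDef; first by apply/cvg_ex; exists (D i j).
exact: cvg_lim cf.
Qed.

Lemma is_derive_scale (g : K^o -> K^o) (a : K^o) (E : 'M[K]_3) :
  is_derive (0 : K^o) (1 : K^o) g a ->
  is_derive (0 : K^o) (1 : K^o) (fun s : K^o => g s *: E) (a *: E).
Proof.
move=> [dg <-]; set D := 'D_ _ _ _.
have cg : h^-1 *: (g (h *: (1 : K^o) + 0) *: E - g 0 *: E) @[h --> (0 : K)^'] --> D *: E.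
  rewrite (_ : (fun h : K => _) =
    (fun h => (h^-1 *: ((g \o shift (0 : K^o)) (h *: (1 : K^o)) - g 0)) *: E)).
    exact: cvgZr_tmp dg.
  by apply/funext => h; rewrite /= -scalerBl scalerA.
apply: DeriveDef; first by apply/cvg_ex; exists (D *: E).
exact: cvg_lim cg.
Qed.

Lemma entry_is_derive f X : entry_derive f X ->
  is_derive (0 : K^o) (1 : K^o) (f : K^o -> 'M[K]_3) X.
Proof.
move=> fX; rewrite (matrix_sum_delta X).
rewrite (_ : f = \sum_i \sum_j (fun s : K^o => f s i j *: delta_mx i j)).
  by apply: is_derive_sum => i; apply: is_derive_sum => j; exact: is_derive_scale.
apply/funext => s; rewrite [LHS]matrix_sum_delta fct_sumE.
by apply: eq_bigr => i _; rewrite fct_sumE.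
Qed.

Lemma entry_deriveM f g X Y : entry_derive f X -> entry_derive g Y ->
  entry_derive (fun s => f s *m g s) (X *m g 0 + f 0 *m Y).
Proof.
move=> fX gY i j.
rewrite (_ : (fun s : K^o => (f s *m g s) i j : K^o) =
    \sum_(k < 3) ((fun s : K^o => f s i k : K^o) * (fun s : K^o => g s k j : K^o))); last first.
  by apply/funext => s; rewrite mxE fct_sumE.
rewrite !mxE -big_split /=; apply: is_derive_sum => k.
rewrite (_ : X i k * _ + _ = f 0 i k *: Y k j + g 0 k j *: X i k).
  exact: is_deriveM.
by rewrite addrC [X i k * _]mulrC.
Qed.

Lemma entry_derive_trace f X : entry_derive f X ->
  is_derive (0 : K^o) (1 : K^o) (fun s : K^o => \tr (f s) : K^o) (\tr X).
Proof.
move=> fX; rewrite (_ : (fun s : K^o => _) = \sum_(k < 3) (fun s : K^o => f s k k : K^o)).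
  exact: is_derive_sum.
by apply/funext => s; rewrite fct_sumE.
Qed.

(** Indices are taken modulo 3, which absorbs the signs of the cofactors. *)
Lemma invmx_entry (M : 'M[K]_3) (i j : 'I_3) : \det M = 1 -> invmx M i j =
  M (j + 1) (i + 1) * M (j + 2) (i + 2) - M (j + 1) (i + 2) * M (j + 2) (i + 1).
Proof.
have [X shX ->] := lmx_surj M => dM; rewrite lmx_inv //.
have [a [b [c [d [e [f [g [h [k ->]]]]]]]]] := shape33P shX.
by move: i j; ord_cases; ord_cases; rewrite !mxE /=; ring.
Qed.

(** With determinant 1 the entries of the inverse are polynomial, hence differentiable;
    differentiating f f^-1 = 1 then gives the formula. *)
Lemma entry_derive_inv f X : (forall s, \det (f s) = 1) -> entry_derive f X ->
  entry_derive (fun s => invmx (f s)) (- (invmx (f 0) *m X *m invmx (f 0))).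
Proof.
move=> df fX.
have [Y gY] : exists Y, entry_derive (fun s => invmx (f s)) Y.
  exists (\matrix_(i, j)
    'D_(1 : K^o) (fun s : K^o => invmx (f s) i j : K^o) (0 : K^o)) => i j.
  rewrite mxE; apply: derivableP.
  rewrite (_ : (fun s : K^o => _) =
    (fun s : K^o => f s (j + 1) (i + 1) : K^o) *
    (fun s : K^o => f s (j + 2) (i + 2) : K^o) -
    (fun s : K^o => f s (j + 1) (i + 2) : K^o) *
    (fun s : K^o => f s (j + 2) (i + 1) : K^o)).
    by apply: derivableB; apply: derivableM; apply: ex_derive.
  by apply/funext => s; rewrite invmx_entry.
suff -> : - (invmx (f 0) *m X *m invmx (f 0)) = Y by [].
have u s : f s \in unitmx by rewrite unitmxE df unitr1.
have := entry_deriveM fX gY; rewrite (_ : (fun s => _) = fun=> 1%:M); last first.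
  by apply/funext => s; rewrite mulmxV.
move=> d1; have e0 : X *m invmx (f 0) + f 0 *m Y = 0.
  apply/matrixP => i j; rewrite [RHS]mxE; apply: is_derive_inj (d1 i j) _.
  exact: is_derive_cst.
apply: (can_inj (mulKmx (u 0))); rewrite mulmxN !mulmxA mulmxV // mul1mx.
by apply/eqP; rewrite eq_sym -addr_eq0 addrC e0.
Qed.

End MatrixDerivative.

(** * Paths of representations with prescribed velocity *)

Section Paths.
Local Open Scope classical_set_scope.
Variable K : numFieldType.

Lemma det_one_plus (z : 'M[K]_3) : exists q r : K, forall s,
  \det (1%:M + s *: z) = 1 + s * \tr z + s * s * (q + s * r).
Proof.
have [X shX ->] := lmx_surj z.
have [a [b [c [d [e [f [g [h [k ->]]]]]]]]] := shape33P shX.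
exists (a * e - b * d + (a * k - c * g) + (e * k - f * h)),
  (ldet 3 [:: [:: a; b; c]; [:: d; e; f]; [:: g; h; k]]) => s.
have -> : 1%:M + s *: lmx 3 [:: [:: a; b; c]; [:: d; e; f]; [:: g; h; k]] =
  lmx 3 [:: [:: 1 + s * a; s * b; s * c]; [:: s * d; 1 + s * e; s * f];
            [:: s * g; s * h; 1 + s * k]].
  by apply/matrixP; ord_cases; ord_cases; rewrite !mxE /= ?add0r.
by rewrite det_lmx // /mxtrace !big_ord_recl big_ord0 !mxE /=; ring.
Qed.

(* The matrix 1 + s z has determinant 1 + O(s^2), so that rescaling its first   *)
(* row by the inverse determinant does not change the velocity at s = 0.        *)
Lemma SL3_path (z : 'M[K]_3) : \tr z = 0 ->
  exists2 N : K -> SL3 K, N 0 = 1%g & entry_derive (fun s => N s) z.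
Proof.
move=> tz; have [q [r dE]] := det_one_plus z.
pose d s := \det (1%:M + s *: z).
pose rowscale s : 'rV[K]_3 := \row_i (if i == 0 then (d s)^-1 else 1).
(* The value 1 where the determinant vanishes is harmless: this does not happen near s = 0. *)
pose M s := if d s == 0 then 1%:M else diag_mx (rowscale s) *m (1%:M + s *: z).
have dM s : \det (M s) == 1.
  rewrite /M; case: (eqVneq (d s) 0) => [_|ds]; first by rewrite det1.
  rewrite det_mulmx det_diag !big_ord_recl big_ord0 !mxE /= !mulr1.
  by rewrite -/(d s) mulVf.
have d0 : d 0 = 1 by rewrite /d dE tz !mul0r !addr0.
exists (fun s => MkSL3 (dM s)).
  apply: val_inj => /=; rewrite /M d0 oner_eq0 scale0r addr0 mulmx1.
  by apply/matrixP => i j; rewrite !mxE d0 invr1 if_same.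
have dd : is_derive (0 : K^o) (1 : K^o) (d : K^o -> K^o) 0.
  rewrite (_ : d = cst (1 : K) + (id * id) * (cst q + id * cst r)); last first.
    by apply/funext => s; rewrite /d dE tz mulr0 addr0.
  have di := @is_derive_id K K^o 0 1; have dcst a := @is_derive_cst K K^o K^o a 0 1.
  apply: is_derive_eq (is_deriveD (dcst 1) (is_deriveM (is_deriveM di di)
    (is_deriveD (dcst q) (is_deriveM di (dcst r))))) _.
  by rewrite /= !fctE /=; rewrite !(scale0r, scaler0, addr0, mul0r, mulr0, add0r).
have dV : is_derive (0 : K^o) (1 : K^o) (fun s : K^o => (d s)^-1 : K^o) 0.
  apply: DeriveDef; first by apply: derivableV; rewrite ?d0 ?oner_eq0.
  by rewrite deriveV ?d0 ?oner_eq0 // derive_val scaler0.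
have dc : (d : K^o -> K^o) s @[s --> (0 : K^o)] --> (d 0 : K^o).
  by apply: differentiable_continuous; apply/derivable1_diffP; apply: ex_derive.
have near_d : \forall s \near (0 : K^o), d s != 0.
  by apply: (cvgr_neq0 _ dc); rewrite d0 oner_eq0.
move=> i j.
pose rs : K^o -> K^o := if i == 0 then (fun s : K^o => (d s)^-1) else cst 1.
have rs0 : rs 0 = 1 by rewrite /rs; case: (i == 0); rewrite ?d0 ?invr1.
have drs : is_derive (0 : K^o) (1 : K^o) rs 0.
  by rewrite /rs; case: (i == 0) => //; exact: is_derive_cst.
apply: (@near_eq_is_derive _ _ _ (rs * (cst ((1%:M : 'M[K]_3) i j) + id * cst (z i j)))).
  near=> s.
  have ds : d s != 0 by near: s.
  rewrite /= /M (negPf ds) mul_diag_mx !mxE /rs -!fctE.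
  by case: (i == 0).
have di := @is_derive_id K K^o 0 1; have dcst a := @is_derive_cst K K^o K^o a 0 1.
apply: is_derive_eq (is_deriveM drs (is_deriveD (dcst _) (is_deriveM di (dcst _)))) _.
rewrite rs0 !fctE /=.
by rewrite !(scale0r, scaler0, addr0, mul0r, mulr0, add0r, scale1r) [_ *: _]mulr1.
Unshelve. all: by end_near. Qed.

Section Velocity.
Variables (F : groupType) (g1 g2 : F) (rho : {multiplicative F -> SL3 K}).

Lemma morph_inv (r : {multiplicative F -> SL3 K}) x : r x^-1%g = (r x)^-1%g.
Proof.
have r1 : r 1%g = 1%g by apply: (mulgI (r 1%g)); rewrite -gmulfM !mulg1.
by apply: (mulgI (r x)); rewrite -gmulfM !mulgV r1.
Qed.

Lemma mem_sl3 (X : 'M[K]_3) : (X \in sl3 K) = (\tr X == 0).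
Proof. by rewrite memv_ker lfunE. Qed.

Lemma path_exists z : free_on g1 g2 -> C1 z ->
  exists p, path_with_velocity g1 g2 rho z p.
Proof.
move=> hF []; rewrite !mem_sl3 => /eqP/SL3_path[N1 N10 dN1] /eqP/SL3_path[N2 N20 dN2].
pose p s := sval (cid (hF (SL3 K) (N1 s * rho g1)%g (N2 s * rho g2)%g)).
have pP s : [/\ p s g1 = (N1 s * rho g1)%g, p s g2 = (N2 s * rho g2)%g &
    forall f' : {multiplicative F -> SL3 K},
      f' g1 = (N1 s * rho g1)%g -> f' g2 = (N2 s * rho g2)%g -> f' =1 p s].
  exact: svalP (cid (hF (SL3 K) (N1 s * rho g1)%g (N2 s * rho g2)%g)).
exists p; split.
(* [p 0] and [rho] agree on the generators, so the uniqueness clause of freeness identifies them. *)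
- have [_ _ u] := pP 0; move=> x; symmetry; apply: u; by rewrite ?N10 ?N20 mul1g.
- apply: entry_is_derive; rewrite (_ : (fun s => _) = (fun s => SL3_mx (N1 s))) //.
  apply/funext => s; have [-> _ _] := pP s.
  by rewrite /= mulmxK // SL3_unitmx.
- apply: entry_is_derive; rewrite (_ : (fun s => _) = (fun s => SL3_mx (N2 s))) //.
  apply/funext => s; have [_ -> _] := pP s.
  by rewrite /= mulmxK // SL3_unitmx.
Qed.

End Velocity.

End Paths.

(** * Differentials of the eight trace functions *)

Section Words.
Local Open Scope classical_set_scope.
Variables (K : numClosedFieldType) (F : groupType) (g1 g2 : F).
Variable rho : {multiplicative F -> SL3 K}.
Local Notation A := (SL3_mx (rho g1)).
Local Notation B := (SL3_mx (rho g2)).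

Definition words : 8.-tuple F :=
  [tuple g1; g1^-1; g2; g2^-1; g1 * g2; g1^-1 * g2^-1; g1 * g2^-1; g1^-1 * g2]%g.

Lemma path_letter (p : K -> {multiplicative F -> SL3 K}) (g : F) (X : 'M[K]_3) :
  p 0 =1 rho ->
  is_derive (0 : K^o) (1 : K^o)
    (fun s : K^o => (p s g : 'M[K]_3) *m ((rho g)^-1)%g : 'M[K]_3) X ->
  entry_derive (fun s => p s g) (X *m rho g) /\
  entry_derive (fun s => p s g^-1%g) (- (invmx (rho g) *m X)).
Proof.
move=> p0 /is_derive_entry dX; have uG := SL3_unitmx (rho g).
have cst_rho : entry_derive (fun=> SL3_mx (rho g)) 0.
  by move=> i j; rewrite mxE; exact: is_derive_cst.
have dg : entry_derive (fun s => p s g) (X *m rho g).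
  have := entry_deriveM dX cst_rho; rewrite mulmx0 addr0.
  rewrite (_ : (fun s => _ *m _) = (fun s => SL3_mx (p s g))) //.
  by apply/funext => s; rewrite mulmxKV.
split=> //; have det1 s : \det (p s g) = 1 by exact/eqP/(valP (p s g)).
have := entry_derive_inv det1 dg; rewrite p0 mulmxA mulmxK //.
rewrite (_ : (fun s => _) = (fun s => SL3_mx (p s g^-1%g))) //.
by apply/funext => s; rewrite morph_inv.
Qed.

Lemma entry_derive_trM (f g : K -> 'M[K]_3) X Y :
  entry_derive f X -> entry_derive g Y ->
  is_derive (0 : K^o) (1 : K^o) (fun s : K^o => \tr (f s *m g s) : K^o)
    (\tr (X *m g 0) + \tr (f 0 *m Y)).
Proof.
by move=> fX gY; rewrite -mxtraceD; exact: entry_derive_trace (entry_deriveM fX gY).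
Qed.

Lemma is_derive_tau p z k : (k < 8)%N -> path_with_velocity g1 g2 rho z p ->
  is_derive (0 : K^o) (1 : K^o) (fun s : K^o => tau (p s) (nth 1%g words k) : K^o)
    (pairing z (word_gradients A B)`_k).
Proof.
move=> lk [p0 v1 v2].
have [d1 d1'] := path_letter p0 v1; have [d2 d2'] := path_letter p0 v2.
have i1 : SL3_mx (rho g1^-1%g) = invmx A by rewrite morph_inv.
have i2 : SL3_mx (rho g2^-1%g) = invmx B by rewrite morph_inv.
have cyc (X Y Z : 'M[K]_3) : \tr (X *m Z *m Y) = \tr (Z *m (Y *m X)).
  by rewrite -mulmxA mxtrace_mulC mulmxA.
have cyc2 (X Y Z : 'M[K]_3) : \tr (X *m (Y *m Z)) = \tr (Z *m (X *m Y)).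
  by rewrite mulmxA mxtrace_mulC.
have cyc3 (X Y Z : 'M[K]_3) : \tr (X *m (Z *m Y)) = \tr (Z *m (Y *m X)).
  by rewrite mulmxA cyc.
have tr1 g X : entry_derive (fun s => p s g) X ->
    is_derive (0 : K^o) (1 : K^o) (fun s : K^o => tau (p s) g : K^o) (\tr X).
  exact: entry_derive_trace.
have tr2 g h X Y : entry_derive (fun s => p s g) X -> entry_derive (fun s => p s h) Y ->
    is_derive (0 : K^o) (1 : K^o) (fun s : K^o => tau (p s) (g * h)%g : K^o)
      (\tr (X *m rho h) + \tr (rho g *m Y)).
  move=> dX dY; rewrite -!p0 (_ : (fun s => _) = (fun s => \tr (p s g *m p s h))).
    exact: entry_derive_trM.
  by apply/funext => s; rewrite /tau gmulfM.
rewrite /pairing; case: k lk => [|[|[|[|[|[|[|[|k]]]]]]]] //= _;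
  rewrite ?mulmx0 ?mxtrace0 ?addr0 ?add0r.
- exact: tr1.
- by apply: is_derive_eq (tr1 _ _ d1') _; rewrite mulmxN !raddfN /= mxtrace_mulC.
- exact: tr1.
- by apply: is_derive_eq (tr1 _ _ d2') _; rewrite mulmxN !raddfN /= mxtrace_mulC.
- by apply: is_derive_eq (tr2 _ _ _ _ d1 d2) _; congr (_ + _); [rewrite mulmxA | exact: cyc3].
- apply: is_derive_eq (tr2 _ _ _ _ d1' d2') _; rewrite i1 i2; congr (_ + _).
    by rewrite mulNmx mulmxN !raddfN /= cyc.
  by rewrite !mulmxN !raddfN /= cyc2.
- apply: is_derive_eq (tr2 _ _ _ _ d1 d2') _; rewrite i2; congr (_ + _).
    by rewrite mulmxA.
  by rewrite !mulmxN !raddfN /= cyc2.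
- apply: is_derive_eq (tr2 _ _ _ _ d1' d2) _; rewrite i1; congr (_ + _).
    by rewrite mulNmx mulmxN !raddfN /= cyc.
  exact: cyc3.
Qed.

(** [dtau] selects a derivative along some path. Freeness provides a path, and [is_derive_tau] gives
    the same value for every path with velocity z. *)
Lemma dtau_word z k : free_on g1 g2 -> C1 z -> (k < 8)%N ->
  dtau g1 g2 rho (nth 1%g words k) z = pairing z (word_gradients A B)`_k.
Proof.
move=> hF Cz lk; apply: xget_unique.
  have [p pP] := path_exists rho hF Cz; exists p => //; exact: is_derive_tau.
move=> v [p pP dv]; apply: is_derive_inj dv _; exact: is_derive_tau.
Qed.

(** * Coordinates of cochains in an orthonormal basis *)

Section Coordinates.
Variable c : 8.-tuple 'M[K]_3.
Hypothesis c_ortho : orthonormal_basis c.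

Lemma orthonormal_trace i : (i < 8)%N -> \tr c`_i = 0.
Proof.
move=> li; apply/eqP; rewrite -mem_sl3; have [/andP[/eqP <- _] _] := c_ortho.
by rewrite memv_span // mem_nth ?size_tuple.
Qed.

Lemma orthonormal_product i j : (i < 8)%N -> (j < 8)%N ->
  \tr (c`_i *m c`_j) = - (i == j)%:R.
Proof.
move=> li lj; have [_ /(_ (Ordinal li) (Ordinal lj))] := c_ortho.
by rewrite /trace_form !(tnth_nth 0) /= => /(canRL opprK) ->.
Qed.

Definition cochain_basis : 16.-tuple (cochain K) :=
  [tuple of [tuple of [seq (X, 0) | X <- c]] ++ [tuple of [seq (0, X) | X <- c]]].

Lemma nth_cochain_basis i : (i < 8)%N ->
  cochain_basis`_i = (c`_i, 0) /\ cochain_basis`_(8 + i) = (0, c`_i).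
Proof.
move=> li; rewrite /= !nth_cat !size_map size_tuple li ltnNge leq_addr /= addKn.
by rewrite !(nth_map 0) ?size_tuple.
Qed.

Lemma pairing_cochain_basis i j : (i < 16)%N -> (j < 16)%N ->
  pairing cochain_basis`_i cochain_basis`_j = - (i == j)%:R.
Proof.
have split k : (k < 16)%N -> (k < 8)%N \/ exists2 l, (l < 8)%N & k = (8 + l)%N.
  move=> lk; case: (ltnP k 8) => k8; [by left | right; exists (k - 8)%N].
    by rewrite ltn_subLR.
  by rewrite subnKC.
move=> /split[li|[i' li ->]] /split[lj|[j' lj ->]]; rewrite /pairing.
- rewrite (nth_cochain_basis li).1 (nth_cochain_basis lj).1 /= mulmx0 mxtrace0 addr0.
  exact: orthonormal_product.
- rewrite (nth_cochain_basis li).1 (nth_cochain_basis lj).2 /= mulmx0 mul0mx mxtrace0 addr0.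
  by rewrite ltn_eqF ?oppr0 // ltn_addr.
- rewrite (nth_cochain_basis li).2 (nth_cochain_basis lj).1 /= mulmx0 mul0mx mxtrace0 addr0.
  by rewrite gtn_eqF ?oppr0 // ltn_addr.
- rewrite (nth_cochain_basis li).2 (nth_cochain_basis lj).2 /= mulmx0 mxtrace0 add0r.
  by rewrite eqn_add2l orthonormal_product.
Qed.

Lemma cochain_basis_span z : C1 z -> z \in <<cochain_basis>>%VS.
Proof.
move=> [z1 z2]; have [/andP[/eqP spanc _] _] := c_ortho.
have mem i : (i < 8)%N -> ((c`_i, 0) : cochain K) \in <<cochain_basis>>%VS /\
     ((0, c`_i) : cochain K) \in <<cochain_basis>>%VS.
  move=> li; have [<- <-] := nth_cochain_basis li.
  by split; apply/memv_span/mem_nth; rewrite size_tuple ?ltn_add2l // (ltn_trans li).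
have -> : z = \sum_(i < 8) (coord c i z.1 *: ((c`_i, 0) : cochain K) +
    coord c i z.2 *: ((0, c`_i) : cochain K)).
  case: z z1 z2 => x y /=; rewrite -spanc => /coord_span xE /coord_span yE.
  apply: injective_projections.
    rewrite (big_morph fst (id1 := 0) (op1 := +%R)) //= {1}xE.
    by apply: eq_bigr => i _; rewrite scaler0 addr0.
  rewrite (big_morph snd (id1 := 0) (op1 := +%R)) //= {1}yE.
  by apply: eq_bigr => i _; rewrite scaler0 add0r.
apply: memv_suml => i _; have [m1 m2] := mem i (ltn_ord i).
by apply: memvD; exact: memvZ.
Qed.

Lemma pairingZl a (z f : cochain K) : pairing (a *: z) f = a * pairing z f.
Proof. by rewrite /pairing -!scalemxAl !mxtraceZ mulrDr. Qed.

Lemma coord_cochain_basis z (j : 'I_16) : C1 z ->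
  coord cochain_basis j z = - pairing z cochain_basis`_j.
Proof.
move=> Cz; rewrite [in RHS](coord_span (cochain_basis_span Cz)).
rewrite (big_morph (fun x : cochain K => pairing x cochain_basis`_j)
  (id1 := 0) (op1 := +%R)); first last.
- by rewrite /pairing !mul0mx mxtrace0 addr0.
- by move=> x y; rewrite /pairing !mulmxDl !mxtraceD addrACA.
rewrite (bigD1 j) //= big1 ?addr0 => [|k kj].
  by rewrite pairingZl pairing_cochain_basis // eqxx mulrN1 opprK.
by rewrite pairingZl pairing_cochain_basis // -[(_ == _)]/(k == j) (negPf kj) oppr0 mulr0.
Qed.

(** Each coordinate is minus a pairing, and the sixteen signs cancel in the determinant. *)
Lemma Omega_pairing (h : 8.-tuple (cochain K)) : (forall j, C1 (tnth h j)) ->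
  Omega g1 g2 rho c h = \det (\matrix_(i < 16, j < 16)
      pairing ([seq coboundary A B X | X <- c] ++ h)`_i (dual_cochains c)`_j).
Proof.
move=> Ch; rewrite /Omega /basis_det.
set G := \matrix_(i < 16, j < 16) pairing _ _.
have <- : \det (- G) = \det G.
  by rewrite -scaleN1r detZ -signr_odd /= expr0 mul1r.
congr determinant; apply/matrixP => i j; rewrite !mxE (tnth_nth 0).
rewrite (@coord_cochain_basis _ j) //.
rewrite /= nth_cat size_map size_tuple; case: ltnP => i8.
  rewrite (nth_map 0) ?size_tuple //.
  have t0 : \tr c`_i = 0 by exact: orthonormal_trace.
  by split; rewrite mem_sl3 !raddfB /= t0 subr0 mxtrace_mulC mulKmx ?t0 ?SL3_unitmx.
have i8' : (i - 8 < 8)%N by rewrite ltn_subLR.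
by have := Ch (Ordinal i8'); rewrite (tnth_nth 0).
Qed.

End Coordinates.

End Words.

Theorem proposition39 (R : realType) (F : groupType) (g1 g2 : F)
    (hF : free_on g1 g2)
    (c : 8.-tuple 'M[R[i]]_3) (hc : orthonormal_basis c) :
  exists2 sign : R[i], sign = 1 \/ sign = -1 &
    forall rho : {multiplicative F -> SL3 R[i]},
      good rho ->
      tau rho (g2 * g1 * g2^-1 * g1^-1)%g
        <> tau rho (g1 * g2 * g1^-1 * g2^-1)%g ->
      forall h : 8.-tuple (cochain R[i]), H1_basis g1 g2 rho h ->
        Omega g1 g2 rho c h =
          sign * (3 * sqrtC (- 3)
                  / (tau rho (g2 * g1 * g2^-1 * g1^-1)%g
                     - tau rho (g1 * g2 * g1^-1 * g2^-1)%g))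
          * wedge_dtau g1 g2 rho
              [tuple g1; g1^-1; g2; g2^-1;
                     g1 * g2; g1^-1 * g2^-1; g1 * g2^-1; g1^-1 * g2]%g h.
Proof.
have [sign sign1 signP] := torsion_gradient_identity (size_tuple c)
  (orthonormal_trace hc) (orthonormal_product hc).
exists sign => // rho _ neq h [Ch _].
have detE : tau rho (g2 * g1 * g2^-1 * g1^-1)%g - tau rho (g1 * g2 * g1^-1 * g2^-1)%g =
    \det (rho g2 *m rho g1 - rho g1 *m rho g2).
  rewrite -det_commutator; [|exact/eqP/(valP (rho g1))|exact/eqP/(valP (rho g2))].
  by rewrite /tau !gmulfM !morph_inv.
rewrite detE Omega_pairing // signP; first last.
- move=> i li; have [t1 t2] := Ch (Ordinal li).
  by move: t1 t2; rewrite (tnth_nth 0) !mem_sl3 => /eqP -> /eqP ->.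
- by rewrite size_tuple.
- by rewrite -detE subr_eq0; apply/eqP.
- exact/eqP/(valP (rho g2)).
- exact/eqP/(valP (rho g1)).
(* Words index the rows in [wedge_dtau] and the columns in the gradient determinant, hence the
   transposition. *)
congr (_ * _); rewrite -det_tr; congr determinant; apply/matrixP => i j.
rewrite !mxE (tnth_nth 1%g) (tnth_nth 0); apply/esym/dtau_word => //.
by have := Ch j; rewrite (tnth_nth 0).
Qed.
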